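(* Let $J$ be an object of $G$. (a) For any morphism $(J,w,K)$ in $G$, $\mathcal{V}(w)({}_K\mathcal{Y})={}_J\mathcal{Y}$ and $\mathcal{V}(w)({}_K\mathcal{Z})={}_J\mathcal{Z}$. (b) ${}_J\mathcal{Z}=(-{}_J\mathcal{X})\cap{}_J\mathcal{Y}$. (c) ${}_J\mathcal{Z}$ is a (convex) cone in ${}_J\mathcal{V}$. (d) ${}_J\widetilde\Upsilon^{\mathrm{im},+}\subseteq{}_J\mathcal{Z}$.
   Context: **Based root systems.** $\operatorname{span}(X)$ is the linear span, $\operatorname{cone}(X)$ the set of finite non-negative linear combinations of elements of $X$ (including $0$). $(V,B)$ is a real vector space with a symmetric bilinear form; $X^\perp=\{v\in V\mid B(v,x)=0\ \forall x\in X\}$; for $B(\alpha,\alpha)\neq 0$, $s_\alpha(v)=v-\frac{2B(v,\alpha)}{B(\alpha,\alpha)}\alpha$. $(\Phi,\Pi)$ is a based root system in $(V,B)$ with associated Coxeter system $(W,S)$: $\Pi\subseteq V$; $\operatorname{cone}(\Pi)\cap\operatorname{cone}(-\Pi)=\{0\}$; for all $\alpha\in\Pi$, $\alpha\notin\operatorname{cone}(\Pi\setminus\{\alpha\})$ and $B(\alpha,\alpha)=1$; $S=\{s_\alpha\mid\alpha\in\Pi\}$, $W=\langle S\rangle$; $\Phi=\{w\alpha\mid w\in W,\alpha\in\Pi\}$ satisfies $\Phi=\Phi^+\cup\Phi^-$ where $\Phi^{\pm}=\Phi\cap\operatorname{cone}(\pm\Pi)$. The rank may be infinite. $T=\{s_\alpha\mid\alpha\in\Phi\}$;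 $N(w)=\{t\in T\mid\ell(tw)<\ell(w)\}$. For $J\subseteq\Pi$, $W_J=\langle s_\alpha\mid\alpha\in J\rangle$. Components of $J\subseteq\Pi$ are taken in the Coxeter graph on $\Pi$ (distinct $\alpha,\beta$ joined iff $s_\alpha s_\beta$ has order $\ge3$ or $\infty$); $J_{\mathrm{fin}}$ is the union of components of $J$ that generate finite groups. **Reflection subgroups.** A reflection subgroup is a subgroup $U=\langle U\cap T\rangle$ of $W$; $\Pi_U=\{\alpha\in\Phi^+\mid N(s_\alpha)\cap U=\{s_\alpha\}\}$. $R_J$ is the set of reflection subgroups $U\supseteq W_J$ with $|\Pi_U\setminus J|=1$ (always $J\subseteq\Pi_U$); for $U\in R_J$, $r_{U,J}\in\Phi^+$ is defined by $\Pi_U=J\sqcup\{r_{U,J}\}$. **Groupoid and standing assumption.** The full Brink-Howlett groupoid has as objects the subsets of $\Pi$; a morphism $J\to K$ is a triple $(K,w,J)$ with $w\in W$, $w(J)=K$; composition $(L,v,K)(K,w,J)=(L,vw,J)$. $G$ is a Brink-Howlett groupoid, i.e. a union of connected components of it. It is assumed that every object $J$ of $G$ satisfies: (i) for all $\alpha\in\Pi$, $B(\alpha,\beta)\neq0$ for only finitely many $\beta\in J_{\mathrm{fin}}$; (ii) $J=J_{\mathrm{fin}}$; (iii) $V=\operatorname{span}(J)\oplus J^\perp$. **Realized roots and cones.** For $J\in\mathrm{ob}(G)$: ${}_J\mathcal{V}=J^\perp$, $B_J$ is the restriction of $B$ to $J^\perp$, $\pi_J\colon V\to J^\perp$ is the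 orthogonal projection, and for a morphism $(K,w,J)$, $\mathcal{V}(w)\colon J^\perp\to K^\perp$ is the restriction of $w\colon V\to V$. ${}_J\Delta=\{\pi_J(\alpha)\mid\alpha\in\Pi\setminus J\}$. ${}_J\widetilde\Upsilon^{+}=\{\pi_J(r_{U,J})\mid U\in R_J\}$ and ${}_J\widetilde\Upsilon^{-}=-{}_J\widetilde\Upsilon^{+}$ (these are disjoint, and their union is permuted by the maps $\mathcal{V}(w)$). ${}_J\widetilde\Upsilon^{\mathrm{im},+}$ is the set of $\alpha\in{}_J\widetilde\Upsilon^{+}$ such that $\mathcal{V}(w)(\alpha)\in{}_K\widetilde\Upsilon^{+}$ for every object $K$ and every morphism $(K,w,J)$ of $G$. Below, unions and intersections run over all objects $K$ of $G$ and all morphisms $(J,w,K)\colon K\to J$ of $G$: - ${}_J\mathcal{C}=\{v\in{}_J\mathcal{V}\mid B_J(v,\alpha)\ge0\ \forall\alpha\in{}_J\Delta\}$, and ${}_J\mathcal{X}=\bigcup_{K}\bigcup_{(J,w,K)}\mathcal{V}(w)({}_K\mathcal{C})$ (Tits cone); - ${}_J\mathcal{K}=(-{}_J\mathcal{C})\cap\operatorname{cone}({}_J\Delta)$; - ${}_J\mathcal{Y}=\bigcap_{K}\bigcap_{(J,w,K)}\mathcal{V}(w)(\operatorname{cone}({}_K\Delta))$; - ${}_J\mathcal{Z}=\bigcup_{K}\bigcup_{(J,w,K)}\mathcal{V}(w)({}_K\mathcal{K})$ (imaginary cone). *)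

(* Defs.v *)
From Stdlib Require Export Relation_Operators.
From HB Require Import structures.
From mathcomp Require Export all_boot all_order all_algebra.
From mathcomp Require Export boolp classical_sets cardinality reals.

Set Implicit Arguments.
Unset Strict Implicit.
Unset Printing Implicit Defensive.

Import Order.TTheory GRing.Theory Num.Theory.
Local Open Scope classical_set_scope.
Local Open Scope ring_scope.

(* The empty combination (n = 0) puts 0 in both lspan X and cone X. *)
Definition lspan (R : realType) (V : lmodType R) (X : set V) : set V :=
  [set v | exists (n : nat) (c : 'I_n -> R) (x : 'I_n -> V),
     (forall i, X (x i)) /\ v = \sum_(i < n) c i *: x i].

Definition cone (R : realType) (V : lmodType R) (X : set V) : set V :=
  [set v | exists (n : nat) (c : 'I_n -> R) (x : 'I_n -> V),
     [/\ forall i, 0 <= c i, forall i, X (x i) &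
         v = \sum_(i < n) c i *: x i]].

Definition convex_cone (R : realType) (V : lmodType R) (A : set V) : Prop :=
  [/\ A 0, forall u v, A u -> A v -> A (u + v) &
      forall c v, 0 <= c -> A v -> A (c *: v)].

Definition direct_sum (R : realType) (V : lmodType R) (A A' : set V) : Prop :=
  (forall v, exists2 a, A a & exists2 a', A' a' & v = a + a') /\
  A `&` A' = [set 0].

(* Subgroups of the group of bijections of T, as sets of maps. *)
Definition is_subgroup (T : Type) (H : set (T -> T)) : Prop :=
  [/\ H id, forall f g, H f -> H g -> H (f \o g) &
      forall f, H f -> exists2 g, H g & cancel f g /\ cancel g f].

Definition generated (T : Type) (X : set (T -> T)) : set (T -> T) :=
  smallest (@is_subgroup T) X.

Section RootSystem.
Variables (R : realType) (V : lmodType R) (B : {symmetric V}).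
Implicit Types (X J K : set V) (t u w : V -> V) (U : set (V -> V)).

Definition perp X : set V := [set v | forall x, X x -> B v x = 0].

Definition refl (a : V) : V -> V := fun v => v - (2 * B v a / B a a) *: a.

Definition parabolic J : set (V -> V) := generated [set refl a | a in J].

(* Unique whenever V is the direct sum of lspan J and perp J. *)
Definition proj J (v : V) : V :=
  xget 0 [set u | perp J u /\ lspan J (v - u)].

(* The composite s_a s_b has order >= 3 or infinite order. *)
Definition joined (a b : V) : Prop :=
  a <> b /\
  forall n : nat, (0 < n < 3)%N -> iter n (refl a \o refl b) <> id.

Definition component J (a : V) : set V :=
  [set b | J b /\
           clos_refl_trans V (fun x y => [/\ J x, J y & joined x y]) a b].

Definition components J : set (set V) := [set component J a | a in J].

Definition Jfin J : set V :=
  \bigcup_(C in [set C | components J C /\ finite_set (parabolic C)]) C.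

Variable Pi : set V.

Definition W : set (V -> V) := parabolic Pi.

Definition Phi : set V := [set v | exists2 w, W w & exists2 a, Pi a & v = w a].
Definition PhiP : set V := Phi `&` cone Pi.
Definition PhiN : set V := Phi `&` cone (-%R @` Pi).

Definition based_root_system : Prop :=
  [/\ cone Pi `&` cone (-%R @` Pi) = [set 0],
      forall a, Pi a -> ~ cone (Pi `\ a) a,
      forall a, Pi a -> B a a = 1 &
      Phi = PhiP `|` PhiN].

Definition T : set (V -> V) := [set refl a | a in Phi].

Definition word (s : seq V) : V -> V := foldr (fun a w => refl a \o w) id s.

Definition is_expr_length w (n : nat) : Prop :=
  exists s : seq V, [/\ size s = n, forall a, a \in s -> Pi a & w = word s].

(* The length of w; the default 0 is only taken outside W. *)
Definition len w : nat :=
  xget 0%N [set n | is_expr_length w n /\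
                    forall m, is_expr_length w m -> (n <= m)%N].

Definition N w : set (V -> V) := [set t | T t /\ (len (t \o w) < len w)%N].

Definition reflection_subgroup U : Prop :=
  U `<=` W /\ U = generated (U `&` T).

Definition Pi_of U : set V :=
  [set a | PhiP a /\ N (refl a) `&` U = [set refl a]].

Definition RJ J : set (set (V -> V)) :=
  [set U | [/\ reflection_subgroup U, parabolic J `<=` U &
               exists r, Pi_of U `\` J = [set r]]].

Definition rUJ U J : V :=
  xget 0 [set r | [/\ PhiP r, ~ J r & Pi_of U = J `|` [set r]]].

(* (K, w, J) is a morphism J -> K of the full Brink-Howlett groupoid. *)
Definition bh_hom K w J : Prop :=
  [/\ K `<=` Pi, J `<=` Pi, W w & w @` J = K].

Definition bh_component J : set (set V) := [set K | exists w, bh_hom K w J].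

(* A union of connected components of the full groupoid is determined by its
   set ob of objects; it contains all full-groupoid morphisms between them. *)
Definition bh_groupoid (ob : set (set V)) : Prop :=
  exists2 A : set (set V), (forall J, A J -> J `<=` Pi) &
    ob = \bigcup_(J in A) bh_component J.

Definition admissible J : Prop :=
  [/\ forall a, Pi a -> finite_set [set b | Jfin J b /\ B a b != 0],
      J = Jfin J &
      direct_sum (lspan J) (perp J)].

Definition Delta J : set V := [set proj J a | a in Pi `\` J].

Definition UpsP J : set V := [set proj J (rUJ U J) | U in RJ J].

Definition cC J : set V :=
  [set v | perp J v /\ forall a, Delta J a -> 0 <= B v a].

Definition cK J : set V := (-%R @` cC J) `&` cone (Delta J).

Variable ob : set (set V).

Definition hom K w J : Prop := [/\ ob K, ob J & bh_hom K w J].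

Definition UpsImP J : set V :=
  [set a | UpsP J a /\ forall K w, hom K w J -> UpsP K (w a)].

(* The images below stand for those under the restrictions of w : V -> V to
   perp K -> perp J: the sets cC K, cone (Delta K), cK K lie in perp K. *)
Definition cX J : set V :=
  [set v | exists K w, hom J w K /\ (w @` cC K) v].

Definition cY J : set V :=
  [set v | forall K w, hom J w K -> (w @` cone (Delta K)) v].

Definition cZ J : set V :=
  [set v | exists K w, hom J w K /\ (w @` cK K) v].

End RootSystem.

(* Main.v *)
Require Import Defs.
From mathcomp Require Import lra ring zify.
Import Order.TTheory GRing.Theory Num.Theory.
Local Open Scope classical_set_scope.
Local Open Scope ring_scope.

Set Implicit Arguments.
Unset Strict Implicit.
Unset Printing Implicit Defensive.

(** Since every v in perp J satisfies B(v, proj J x) = B(v, x), the chamber of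
    J consists of the elements of perp J that are dominant for all of Pi. Since
    the components of J generate finite groups, averaging over such groups
    shows that proj J maps simple roots into cone Pi ([proj_simple_cone]), so
    that cone (Delta J) is the intersection of perp J and cone Pi
    ([cone_DeltaP]).

    The Tits cone of J is the intersection of perp J with the Tits cone of the
    Coxeter group ([cXP]): if v in perp J has a dominant image, then an element
    of least length making v dominant maps J into Pi, hence is a morphism of
    the groupoid ([tits_vanish]). The Tits cone of the Coxeter group is convex,
    being the set of vectors at which only finitely many positive roots are
    negative ([tits_neg_finite], [neg_finite_tits]). A vector of cone Pi whose
    opposite is dominant only grows under the group, so it stays in cone Pi
    ([antidominant_cone]). This gives the description of the imaginary cone as
    the intersection of the opposite of the Tits cone with the cone cY J
    ([cZP]), and with it the first three claims.

    For the last claim, let a = proj J r be imaginary, where r is a positive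
    root; by the description above, it remains to find an element of the group
    that makes -a dominant ([imaginary_tits]). Up to a positive factor a is a
    sum of roots y r, with y in a finite subgroup generated by elements of J.
    Let S be a finite set of simple roots that carries these roots.

    - All images of a under the group generated by S have non-negative
      coordinates ([lifta_coord]). A coordinate of w a is the value at a of a
      linear form in the dual Tits cone; after averaging, this form vanishes
      on J, so that it becomes dominant under a morphism starting at J, and
      morphisms keep a positive by assumption.

    - B(a, a) <= 0, for otherwise simple reflections could lower the sum of the
      coordinates by a fixed amount for ever ([a_norm_le0]).

    - As B(a, y r) = B(a, a) <= 0, applying simple reflections in roots b with
      B(w a, b) > 0 never makes a root w y r negative, while it lowers the
      sum of the coordinates. There are finitely many positive roots of
      bounded height, because roots with close coordinates coincide
      ([close_roots_eq]); so the process ends, which means that -w a is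
      dominant.

    Coordinates and linear forms have to be taken in the vector space freely
    generated by Pi, as Pi may be linearly dependent. Roots lift to this space
    in a unique way ([lift_unique]) and with the same sign ([lift_sign],
    [pos_liftP]). Its dual is represented by the functions on Pi, and a lifted
    root by a linear form on such functions. *)

(** * Cones and spans *)

Section Cones.
Variables (R : realType) (V : lmodType R).
Implicit Types (X Y : set V) (x y v : V) (c : R).

Lemma cone0 X : cone X 0.
Proof.
exists 0%N, (fun=> 0), (fun=> 0); split=> [i|[]//|]; first exact: lexx.
by rewrite big_ord0.
Qed.

Lemma coneZ X c v : 0 <= c -> cone X v -> cone X (c *: v).
Proof.
move=> c0 [n [d [x [d0 Xx ->]]]]; exists n, (fun i => c * d i), x.
split=> // [i|]; first by rewrite mulr_ge0.
by rewrite scaler_sumr; apply: eq_bigr => i _; rewrite scalerA.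
Qed.

Lemma coneD X u v : cone X u -> cone X v -> cone X (u + v).
Proof.
move=> [n [c [x [c0 Xx ->]]]] [m [d [y [d0 Xy ->]]]].
exists (n + m)%N.
exists (fun i => match split i with inl j => c j | inr j => d j end).
exists (fun i => match split i with inl j => x j | inr j => y j end).
split=> [i|i|]; [by case: splitP|by case: splitP|].
rewrite big_split_ord /=; congr (_ + _); apply: eq_bigr => i _.
  by rewrite -[lshift _ _]/(unsplit (inl i)) unsplitK.
by rewrite -[rshift _ _]/(unsplit (inr i)) unsplitK.
Qed.

Lemma cone_mem X v : X v -> cone X v.
Proof.
move=> Xv; exists 1%N, (fun=> 1), (fun=> v); split=> //.
by rewrite big_ord1 scale1r.
Qed.

Lemma cone_sum X (I : Type) (r : seq I) (P : pred I) (F : I -> V) :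
  (forall i, P i -> cone X (F i)) -> cone X (\sum_(i <- r | P i) F i).
Proof. by move=> H; elim/big_ind: _ => //; [exact: cone0|exact: coneD]. Qed.

(** A cone is contained in every convex cone through its generators. *)
Lemma cone_ind X (P : V -> Prop) :
  P 0 -> (forall u v, P u -> P v -> P (u + v)) ->
  (forall c v, 0 <= c -> X v -> P (c *: v)) -> forall v, cone X v -> P v.
Proof.
move=> P0 PD PZ v [n [c [x [c0 Xx ->]]]].
by elim/big_ind: _ => // i _; exact: PZ.
Qed.

Lemma cone_sub X Y : X `<=` cone Y -> cone X `<=` cone Y.
Proof.
move=> XY; apply: cone_ind; [exact: cone0|exact: coneD|].
by move=> c v c0 /XY; exact: coneZ.
Qed.

Lemma coneN X v : cone (-%R @` X) v <-> cone X (- v).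
Proof.
split.
  move: v; apply: cone_ind; first by rewrite oppr0; exact: cone0.
    by move=> u v Xu Xv; rewrite opprD; exact: coneD.
  move=> c _ c0 [v Xv <-]; rewrite scalerN opprK.
  by apply: coneZ => //; exact: cone_mem.
rewrite -{2}[v]opprK; move: (- v); apply: cone_ind; first by rewrite oppr0; exact: cone0.
  by move=> u w Xu Xw; rewrite opprD; exact: coneD.
move=> c w c0 Xw; rewrite -scalerN; apply: coneZ => //.
by apply: cone_mem; exists w.
Qed.

Lemma lspan_ind X (P : V -> Prop) :
  P 0 -> (forall u v, P u -> P v -> P (u + v)) ->
  (forall c v, X v -> P (c *: v)) -> forall v, lspan X v -> P v.
Proof.
move=> P0 PD PZ v [n [c [x [Xx ->]]]].
by elim/big_ind: _ => // i _; exact: PZ.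
Qed.

Lemma lspan0 X : lspan X 0.
Proof.
by exists 0%N, (fun=> 0), (fun=> 0); split=> [[]//|]; rewrite big_ord0.
Qed.

Lemma lspanD X u v : lspan X u -> lspan X v -> lspan X (u + v).
Proof.
move=> [n [c [x [Xx ->]]]] [m [d [y [Xy ->]]]].
exists (n + m)%N.
exists (fun i => match split i with inl j => c j | inr j => d j end).
exists (fun i => match split i with inl j => x j | inr j => y j end).
split=> [i|]; first by case: splitP.
rewrite big_split_ord /=; congr (_ + _); apply: eq_bigr => i _.
  by rewrite -[lshift _ _]/(unsplit (inl i)) unsplitK.
by rewrite -[rshift _ _]/(unsplit (inr i)) unsplitK.
Qed.

Lemma lspanZ X c v : lspan X v -> lspan X (c *: v).
Proof.
move=> [n [d [x [Xx ->]]]]; exists n, (fun i => c * d i), x; split=> //.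
by rewrite scaler_sumr; apply: eq_bigr => i _; rewrite scalerA.
Qed.

Lemma lspan_mem X v : X v -> lspan X v.
Proof.
move=> Xv; exists 1%N, (fun=> 1), (fun=> v); split=> //.
by rewrite big_ord1 scale1r.
Qed.

Lemma lspanN X v : lspan X v -> lspan X (- v).
Proof. by rewrite -scaleN1r; exact: lspanZ. Qed.

Lemma lspan_sum X (I : Type) (r : seq I) (P : pred I) (F : I -> V) :
  (forall i, P i -> lspan X (F i)) -> lspan X (\sum_(i <- r | P i) F i).
Proof. by move=> H; elim/big_ind: _ => //; [exact: lspan0|exact: lspanD]. Qed.

End Cones.

(** * Reflections, words and their action on functions *)

Section Words.
Variables (R : realType) (V : lmodType R) (B : {symmetric V}).
Implicit Types (X : set V) (x y u v a b : V) (f g : V -> R) (s t : seq V).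

Lemma formC x y : B x y = B y x.
Proof. by rewrite hermC /= expr0 mul1r. Qed.

Lemma formDl x y z : B (x + y) z = B x z + B y z.
Proof. by rewrite linearDl. Qed.

Lemma formBl x y z : B (x - y) z = B x z - B y z.
Proof. by rewrite linearBl. Qed.

Lemma formNl x y : B (- x) y = - B x y.
Proof. by rewrite linearNl. Qed.

Lemma form0l y : B 0 y = 0.
Proof. by rewrite linear0l. Qed.

Lemma formZl (c : R) x y : B (c *: x) y = c * B x y.
Proof. by rewrite linearZl_LR. Qed.

Lemma formDr x y z : B z (x + y) = B z x + B z y.
Proof. by rewrite linearDr. Qed.

Lemma formBr x y z : B z (x - y) = B z x - B z y.
Proof. by rewrite linearBr. Qed.

Lemma formZr (c : R) x y : B y (c *: x) = c * B y x.
Proof. by rewrite linearZr. Qed.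

Lemma form_suml (I : Type) (r : seq I) (F : I -> V) y :
  B (\sum_(i <- r) F i) y = \sum_(i <- r) B (F i) y.
Proof.
elim: r => [|i r IH]; first by rewrite !big_nil form0l.
by rewrite !big_cons formDl IH.
Qed.

Lemma form_sumr (I : Type) (r : seq I) (F : I -> V) y :
  B y (\sum_(i <- r) F i) = \sum_(i <- r) B y (F i).
Proof. by rewrite formC form_suml; apply: eq_bigr => i _; rewrite formC. Qed.

Lemma perp_lspan X v : perp B X v -> forall u, lspan X u -> B v u = 0.
Proof.
move=> Xv; apply: lspan_ind; first by rewrite formC form0l.
  by move=> u w hu hw; rewrite formDr hu hw addr0.
by move=> c w /Xv Xw; rewrite formZr Xw mulr0.
Qed.

Lemma perpD X u v : perp B X u -> perp B X v -> perp B X (u + v).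
Proof. by move=> Xu Xv x Xx; rewrite formDl Xu ?Xv ?addr0. Qed.

Lemma perpZ X c v : perp B X v -> perp B X (c *: v).
Proof. by move=> Xv x Xx; rewrite formZl Xv ?mulr0. Qed.

Lemma perpN X v : perp B X v -> perp B X (- v).
Proof. by move=> Xv x Xx; rewrite formNl Xv ?oppr0. Qed.

Section UnitRoot.
Variable a : V.
Hypothesis a1 : B a a = 1.

Lemma reflE v : refl B a v = v - (2 * B v a) *: a.
Proof. by rewrite /refl a1 divr1. Qed.

Lemma reflK : involutive (refl B a).
Proof.
move=> v; rewrite !reflE formBl formZl a1 mulr1.
have -> : 2 * (B v a - 2 * B v a) = - (2 * B v a) by ring.
by rewrite scaleNr opprK subrK.
Qed.

Lemma refl_form x y : B (refl B a x) (refl B a y) = B x y.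
Proof.
rewrite !reflE !formBl !formBr !formZl !formZr a1 (formC a y); ring.
Qed.

Lemma refl_self : refl B a a = - a.
Proof. by rewrite reflE a1 mulr1 scaler_nat mulr2n opprD addrA subrr add0r. Qed.

Lemma reflD x y : refl B a (x + y) = refl B a x + refl B a y.
Proof. by rewrite !reflE formDl mulrDr scalerDl opprD addrACA. Qed.

Lemma reflZ c x : refl B a (c *: x) = c *: refl B a x.
Proof. by rewrite !reflE formZl scalerBr scalerA mulrCA. Qed.

End UnitRoot.

Section UnitRoots.
Variable Pi : set V.
Hypothesis Pi1 : forall a, Pi a -> B a a = 1.

(** A word whose letters belong to a set of vectors. *)
Definition letters X s : Prop := forall a, a \in s -> X a.

Lemma letters_cons X a s : letters X (a :: s) <-> X a /\ letters X s.
Proof.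
split=> [H|[Xa Xs] b]; last by rewrite inE => /orP[/eqP->|/Xs].
by split=> [|b bs]; apply: H; rewrite inE ?eqxx ?bs ?orbT.
Qed.

Lemma letters_cat X s t : letters X (s ++ t) <-> letters X s /\ letters X t.
Proof.
split=> [H|[Xs Xt] b]; last by rewrite mem_cat => /orP[/Xs|/Xt].
by split=> b bs; apply: H; rewrite mem_cat bs ?orbT.
Qed.

Lemma letters_rcons X s a : letters X (rcons s a) <-> letters X s /\ X a.
Proof.
rewrite -cats1 letters_cat letters_cons; split=> [[? []]|[? ?]] //.
Qed.

Lemma letters_rev X s : letters X (rev s) <-> letters X s.
Proof. by split=> H a; have := H a; rewrite mem_rev. Qed.

Lemma letters_nil X : letters X [::]. Proof. by []. Qed.

Lemma letters_sub X Y s : X `<=` Y -> letters X s -> letters Y s.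
Proof. by move=> XY Xs a /Xs /XY. Qed.

Lemma word_cat s t v : word B (s ++ t) v = word B s (word B t v).
Proof. by elim: s => //= a s ->. Qed.

Lemma word_rcons s a v : word B (rcons s a) v = word B s (refl B a v).
Proof. by rewrite -cats1 word_cat. Qed.

Section PiWord.
Variable s : seq V.
Hypothesis sPi : letters Pi s.

Lemma wordD x y : word B s (x + y) = word B s x + word B s y.
Proof.
elim: s sPi => //= a s' IH /letters_cons[/Pi1 a1 s'P].
by rewrite /= IH // (reflD a1).
Qed.

Lemma wordZ c x : word B s (c *: x) = c *: word B s x.
Proof.
elim: s sPi => //= a s' IH /letters_cons[/Pi1 a1 s'P].
by rewrite /= IH // (reflZ a1).
Qed.

Lemma wordN x : word B s (- x) = - word B s x.
Proof. by rewrite -scaleN1r wordZ scaleN1r. Qed.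

Lemma wordB x y : word B s (x - y) = word B s x - word B s y.
Proof. by rewrite wordD wordN. Qed.

Lemma word0 : word B s 0 = 0.
Proof. by have := wordZ 0 0; rewrite !scale0r. Qed.

Lemma word_sum (I : Type) (r : seq I) (F : I -> V) :
  word B s (\sum_(i <- r) F i) = \sum_(i <- r) word B s (F i).
Proof.
elim: r => [|i r IH]; first by rewrite !big_nil word0.
by rewrite !big_cons wordD IH.
Qed.

Lemma word_form x y : B (word B s x) (word B s y) = B x y.
Proof.
elim: s sPi x y => //= a s' IH /letters_cons[/Pi1 a1 s'P] x y.
by rewrite /= refl_form // IH.
Qed.

Lemma word_revK v : word B (rev s) (word B s v) = v.
Proof.
elim: s sPi v => //= a s' IH /letters_cons[/Pi1 a1 s'P] v.
by rewrite rev_cons word_rcons /= reflK // IH.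
Qed.

Lemma word_lspan v X : (forall a, a \in s -> X a) -> lspan X (word B s v - v).
Proof.
elim: s sPi => [_ _|a s' IH /letters_cons[/Pi1 a1 s'P] Xs].
  by rewrite subrr; exact: lspan0.
rewrite /= reflE // -addrA [- _ + _]addrC addrA; apply: lspanD.
  by apply: IH => // b bs; apply: Xs; rewrite inE bs orbT.
by apply/lspanN/lspanZ/lspan_mem/Xs; rewrite mem_head.
Qed.

End PiWord.

Lemma word_Krev s v : letters Pi s -> word B s (word B (rev s) v) = v.
Proof. by move=> /letters_rev/word_revK; rewrite revK; exact. Qed.

(** The reflection in w a is the conjugate by w of the reflection in a. *)
Lemma refl_word s a v : letters Pi s -> B a a = 1 ->
  refl B (word B s a) (word B s v) = word B s (refl B a v).
Proof.
move=> sP a1; rewrite !reflE ?(word_form sP) //.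
by rewrite (wordB sP) (wordZ sP).
Qed.

(** The dual action of a simple reflection on functions; only the values on
    simple roots matter, so that functions f : V -> R restricted to the simple
    roots are arbitrary linear forms on the vector space freely generated by
    the simple roots. *)
Definition dual_refl a f : V -> R := fun v => f v - 2 * B v a * f a.

Definition dual_word s f : V -> R := foldr dual_refl f s.

Lemma dual_word_cat s t f : dual_word (s ++ t) f = dual_word s (dual_word t f).
Proof. by elim: s => //= a s ->. Qed.

Lemma dual_word_rcons s a f : dual_word (rcons s a) f = dual_word s (dual_refl a f).
Proof. by rewrite -cats1 dual_word_cat. Qed.

Lemma dual_reflK a : B a a = 1 -> involutive (dual_refl a).
Proof. by move=> a1 f; apply/funext => v; rewrite /dual_refl a1; ring. Qed.

Lemma dual_word_revK s f : letters Pi s -> dual_word (rev s) (dual_word s f) = f.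
Proof.
elim: s f => //= a s' IH f /letters_cons[/Pi1 a1 s'P].
by rewrite rev_cons dual_word_rcons dual_reflK // IH.
Qed.

Lemma dual_word_Krev s f : letters Pi s -> dual_word s (dual_word (rev s) f) = f.
Proof. by move=> /letters_rev/dual_word_revK; rewrite revK; exact. Qed.

Lemma dual_wordD s f g :
  dual_word s (fun v => f v + g v) = (fun v => dual_word s f v + dual_word s g v).
Proof.
by elim: s => //= a s ->; apply/funext => v; rewrite /dual_refl; ring.
Qed.

Lemma dual_wordZ s c f :
  dual_word s (fun v => c * f v) = (fun v => c * dual_word s f v).
Proof.
by elim: s => //= a s ->; apply/funext => v; rewrite /dual_refl; ring.
Qed.

Lemma dual_word0 s : dual_word s (fun=> 0) = (fun=> 0).
Proof.
by elim: s => //= a s ->; apply/funext => v; rewrite /dual_refl; ring.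
Qed.

Lemma dual_word_sum s (I : Type) (r : seq I) (F : I -> V -> R) :
  dual_word s (fun v => \sum_(i <- r) F i v) =
  (fun v => \sum_(i <- r) dual_word s (F i) v).
Proof.
elim: r => [|i r IH].
  rewrite (_ : (fun v => _) = fun=> 0) ?dual_word0; apply/funext => v;
  by rewrite big_nil.
rewrite (_ : (fun v => _) = fun v => F i v + \sum_(j <- r) F j v); last first.
  by apply/funext => v; rewrite big_cons.
by rewrite dual_wordD IH; apply/funext => v; rewrite big_cons.
Qed.

(** The dual action extends the action on V through v |-> B(v, -). *)
Lemma dual_word_form s v : letters Pi s -> dual_word s (B v) = B (word B s v).
Proof.
elim: s => //= a s IH /letters_cons[/Pi1 a1 sP].
rewrite IH //; apply/funext => w; rewrite /dual_refl reflE // formBl formZl.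
by rewrite (formC w a); ring.
Qed.

(** Reflections in simple roots orthogonal to v do not change the value at v. *)
Lemma dual_word_orth s f v : (forall a, a \in s -> B v a = 0) ->
  dual_word s f v = f v.
Proof.
elim: s => //= a s IH H; rewrite /dual_refl H ?mem_head // mulr0 mul0r subr0.
by apply: IH => b bs; apply: H; rewrite inE bs orbT.
Qed.

(** The values of f on the formal root [word s a]: this is the lift of that
    root to the vector space freely generated by the simple roots, seen as a
    linear form on the dual of that space. *)
Definition lift s a : (V -> R) -> R := fun f => dual_word (rev s) f a.

Lemma lift_cons b s a f : lift (b :: s) a f = lift s a (dual_refl b f).
Proof. by rewrite /lift rev_cons dual_word_rcons. Qed.

Lemma lift_cat s t a f : lift (s ++ t) a f = lift t a (dual_word (rev s) f).
Proof. by rewrite /lift rev_cat dual_word_cat. Qed.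

Lemma liftD s a f g : lift s a (fun v => f v + g v) = lift s a f + lift s a g.
Proof. by rewrite /lift dual_wordD. Qed.

Lemma liftZ s a c f : lift s a (fun v => c * f v) = c * lift s a f.
Proof. by rewrite /lift dual_wordZ. Qed.

Lemma lift_sum s a (I : Type) (r : seq I) (F : I -> V -> R) :
  lift s a (fun v => \sum_(i <- r) F i v) = \sum_(i <- r) lift s a (F i).
Proof. by rewrite /lift dual_word_sum. Qed.

(** The coordinate function of the simple root a. *)
Definition coord a : V -> R := fun b => (b == a)%:R.

Lemma lift_form s a v : letters Pi s -> lift s a (B v) = B v (word B s a).
Proof.
move=> sP; rewrite /lift dual_word_form; last exact/letters_rev.
by rewrite -[X in B _ X](word_revK sP) word_form //; exact/letters_rev.
Qed.

(** A formal root is the combination of simple roots given by its coordinates,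
    and its image in V is the corresponding root. *)
Lemma lift_coord (S : seq V) s a f : uniq S -> letters Pi s ->
  {subset s <= S} -> a \in S ->
  lift s a f = \sum_(b <- S) lift s a (coord b) * f b.
Proof.
move=> uS; elim: s f => [|b s IH] f sP sS aS.
  rewrite /lift /= (bigD1_seq a) //= /coord eqxx mul1r big1 ?addr0 //.
  by move=> b ba; rewrite eq_sym (negbTE ba) mul0r.
move/letters_cons: sP => [Pb sP].
have bS : b \in S by apply: sS; rewrite mem_head.
have sS' : {subset s <= S} by move=> c cs; apply: sS; rewrite inE cs orbT.
have {}IH g := IH g sP sS' aS.
have E g : lift s a (dual_refl b g) =
    lift s a g - 2 * (\sum_(c <- S) lift s a (coord c) * B c b) * g b.
  rewrite [LHS]IH /dual_refl [in RHS]IH mulr_sumr mulr_suml -sumrB.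
  by apply: eq_bigr => c _; ring.
rewrite lift_cons E; set K := 2 * _.
under eq_bigr do rewrite lift_cons E.
rewrite -/K; under eq_bigr do rewrite mulrBl.
rewrite sumrB -IH; congr (_ - _); rewrite (bigD1_seq b) //= /coord eqxx mulr1.
by rewrite big1 ?addr0 // => c cb; rewrite eq_sym (negbTE cb) mulr0 mul0r.
Qed.

Lemma word_coord (S : seq V) s a : uniq S -> letters Pi s ->
  {subset s <= S} -> a \in S ->
  word B s a = \sum_(b <- S) lift s a (coord b) *: b.
Proof.
move=> uS; elim: s => [|b s IH] sP sS aS.
  rewrite /lift /= (bigD1_seq a) //= /coord eqxx scale1r big1 ?addr0 //.
  by move=> b ba; rewrite eq_sym (negbTE ba) scale0r.
move/letters_cons: sP => [Pb sP].
have bS : b \in S by apply: sS; rewrite mem_head.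
have sS' : {subset s <= S} by move=> c cs; apply: sS; rewrite inE cs orbT.
rewrite /= IH // reflE ?Pi1 // -[X in B X b]IH //.
have E c : lift (b :: s) a (coord c) =
    lift s a (coord c) - 2 * B (word B s a) b * coord c b.
  rewrite lift_cons /dual_refl.
  rewrite (_ : (fun v => _) = (fun v => coord c v + - 2 * coord c b * B b v));
    last by apply/funext => v; rewrite (formC b); ring.
  by rewrite liftD liftZ lift_form // (formC b); ring.
under [RHS]eq_bigr do rewrite E scalerBl.
rewrite sumrB; congr (_ - _); rewrite (bigD1_seq b) //= /coord eqxx mulr1.
by rewrite big1 ?addr0 // => c cb; rewrite eq_sym (negbTE cb) mulr0 scale0r.
Qed.

End UnitRoots.
End Words.

(** * Positive and negative roots *)

Section Roots.
Variables (R : realType) (V : lmodType R) (B : {symmetric V}) (Pi : set V).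
Hypothesis HPi : based_root_system B Pi.
Implicit Types (X J : set V) (x y a b : V) (f g : V -> R) (s t u : seq V).

Lemma simple_norm a : Pi a -> B a a = 1.
Proof. by case: HPi => _ _ H _; exact: H. Qed.

Let Pi1 := simple_norm.

(** The elements of a standard parabolic subgroup are the words in its simple
    roots. *)
Lemma parabolicP J w : J `<=` Pi ->
  parabolic B J w <-> exists2 s, letters J s & w = word B s.
Proof.
move=> JP; split.
  move=> H; apply: (H [set w | exists2 s, letters J s & w = word B s]).
  split; last first.
    move=> _ [a Ja <-]; exists [:: a] => //.
    by move=> b; rewrite inE => /eqP->.
  split; first by exists [::].
    move=> _ _ [s sJ ->] [t tJ ->]; exists (s ++ t); first exact/letters_cat.
    by apply/funext => v; rewrite word_cat.
  move=> _ [s sJ ->]; have sP := letters_sub JP sJ.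
  exists (word B (rev s)); first by exists (rev s) => //; exact/letters_rev.
  split=> v; first exact: word_revK Pi1 _ sP _.
  exact: word_Krev Pi1 _ _ sP.
move=> [s sJ ->] A [[Aid Acomp _] XA].
elim: s sJ => [//|a s IH /letters_cons[Ja sJ]].
apply: (Acomp (refl B a) (word B s)); last exact: IH.
by apply: XA; exists a.
Qed.

Lemma cone_pointed x : cone Pi x -> cone Pi (- x) -> x = 0.
Proof.
case: HPi => H _ _ _ Px Nx; suff : [set 0] x by [].
by rewrite -H; split=> //; exact/coneN.
Qed.

Lemma unit_neq0 x : B x x = 1 -> x <> 0.
Proof.
by move=> + x0; rewrite x0 form0l => /esym/eqP; rewrite oner_eq0.
Qed.

Lemma word_norm s a : letters Pi s -> Pi a -> B (word B s a) (word B s a) = 1.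
Proof. by move=> sP Pa; rewrite (word_form Pi1 sP) Pi1. Qed.

Lemma root_sign s a : letters Pi s -> Pi a ->
  cone Pi (word B s a) \/ cone Pi (- word B s a).
Proof.
move=> sP Pa; case: HPi => _ _ _ H.
have : Phi B Pi (word B s a).
  exists (word B s); last by exists a.
  by apply/parabolicP => //; exists s.
by rewrite H => -[[_ ?]|[_ /coneN]]; [left|right].
Qed.

Lemma root_not_both s a : letters Pi s -> Pi a ->
  cone Pi (word B s a) -> ~ cone Pi (- word B s a).
Proof.
move=> sP Pa Px Nx; apply: (unit_neq0 (word_norm sP Pa)).
exact: cone_pointed.
Qed.

Lemma cone_split a x : Pi a -> cone Pi x ->
  exists (b : R) x', [/\ 0 <= b, cone (Pi `\ a) x' & x = b *: a + x'].
Proof.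
move=> Pa; move: x; apply: cone_ind.
- by exists 0, 0; rewrite lexx scale0r addr0; split=> //; exact: cone0.
- move=> y v [b [u' [b0 Cu ->]]] [c [v' [c0 Cv ->]]].
  exists (b + c), (u' + v'); rewrite addr_ge0 // scalerDl addrACA; split=> //.
  exact: coneD.
- move=> c v c0 Pv; have [<-|va] := pselect (v = a).
    by exists c, 0; rewrite c0 addr0; split=> //; exact: cone0.
  exists 0, (c *: v); rewrite lexx scale0r add0r; split=> //.
  by apply: coneZ => //; apply: cone_mem; split.
Qed.

Lemma cone_setD1 a x : cone (Pi `\ a) x -> cone Pi x.
Proof. by apply: cone_sub => b [Pb _]; exact: cone_mem. Qed.

(** Simple roots span extreme rays. *)
Lemma simple_extreme a c x y : Pi a -> cone Pi x -> cone Pi y ->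
  x + y = c *: a -> exists2 b : R, 0 <= b & x = b *: a.
Proof.
move=> Pa Px Py; have [b [x' [b0 Cx ->]]] := cone_split Pa Px.
have [b' [y' [b'0 Cy ->]]] := cone_split Pa Py => E.
have {}E : x' + y' = (c - b - b') *: a.
  rewrite -[c - b - b']addrA -opprD scalerBl -E addrACA -scalerDl.
  by rewrite [X in X - _]addrC addrK.
have Cz : cone (Pi `\ a) (x' + y') by exact: coneD.
have [k0|k0] := ltP 0 (c - b - b').
  case: HPi => _ /(_ _ Pa) + _ _ => -[].
  rewrite -[X in cone _ X]scale1r -(mulVf (lt0r_neq0 k0)) -scalerA -E.
  by apply: coneZ => //; rewrite invr_ge0 ltW.
have z0 : x' + y' = 0.
  apply: cone_pointed; first exact: cone_setD1 Cz.
  by rewrite E -scaleNr; apply: coneZ; [rewrite oppr_ge0|exact: cone_mem].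
have x0 : x' = 0.
  apply: cone_pointed; first exact: cone_setD1 Cx.
  rewrite (_ : - x' = y'); first exact: cone_setD1 Cy.
  by rewrite -[y'](addKr x') z0 addr0.
by exists b => //; rewrite x0 addr0.
Qed.

Lemma simple_extreme_root a c s b y : Pi a -> letters Pi s -> Pi b ->
  cone Pi (word B s b) -> cone Pi y -> word B s b + y = c *: a ->
  word B s b = a.
Proof.
move=> Pa sP Pb Cx Cy /(simple_extreme Pa Cx Cy)[k k0 E].
have := word_norm sP Pb; rewrite E formZl formZr (Pi1 Pa) mulr1 => k2.
suff -> : k = 1 by rewrite scale1r.
by nra.
Qed.

(** A simple reflection permutes the other positive roots. *)
Lemma refl_pos a s b : Pi a -> letters Pi s -> Pi b ->
  cone Pi (word B s b) -> word B s b <> a ->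
  cone Pi (word B (a :: s) b).
Proof.
move=> Pa sP Pb Cx xa.
have [|//|Cy] := @root_sign (a :: s) b _ Pb; first exact/letters_cons.
case: xa; apply: (@simple_extreme_root _ (2 * B (word B s b) a) s b _ _ _ _ _ Cy) => //.
by rewrite /= reflE ?Pi1 // opprB addrCA subrr addr0.
Qed.

(** A combination of two simple roots that lies in the cone of all simple
    roots has non-negative coefficients, even if the other simple roots depend
    linearly on these two. *)
Lemma comb2_ge0 a b p q : Pi a -> Pi b -> a <> b -> cone Pi (p *: a + q *: b) ->
  0 <= p.
Proof.
move=> Pa Pb ab Cz; rewrite leNgt; apply/negP => p0.
have Ca : cone Pi ((- p) *: a).
  by apply: coneZ; [rewrite oppr_ge0 ltW|exact: cone_mem].
have [|k k0 E] := simple_extreme (c := q) Pb Ca Cz.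
  by rewrite addrA -scalerDl addNr scale0r add0r.
case: HPi => _ /(_ _ Pa) + _ _ => -[].
have p0' : - p != 0 by rewrite oppr_eq0 lt_eqF.
rewrite -[X in cone _ X]scale1r -(mulVf p0') -scalerA E.
apply: coneZ; first by rewrite invr_ge0 oppr_ge0 ltW.
by apply: coneZ => //; apply: cone_mem; split=> // /esym.
Qed.

Lemma comb2_eq0 a b p q : Pi a -> Pi b -> a <> b -> p *: a + q *: b = 0 ->
  p = 0 /\ q = 0.
Proof.
move=> Pa Pb ab E.
have H x y c d : Pi x -> Pi y -> x <> y -> c *: x + d *: y = 0 -> c = 0.
  move=> Px Py xy E'; apply/eqP; rewrite eq_le; apply/andP; split; last first.
    by apply: (comb2_ge0 Px Py xy (q := d)); rewrite E'; exact: cone0.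
  rewrite -oppr_ge0; apply: (comb2_ge0 Px Py xy (q := - d)).
  by rewrite !scaleNr -opprD E' oppr0; exact: cone0.
split; first exact: H ab E.
by apply: (H b a q p Pb Pa _ _); [exact/nesym|rewrite addrC].
Qed.

Lemma simple_form_le0 a b : Pi a -> Pi b -> a <> b -> B a b <= 0.
Proof.
move=> Pa Pb ab.
have : cone Pi (word B (a :: [::]) b).
  by apply: refl_pos => //=; [exact: cone_mem|exact/nesym].
rewrite /= reflE ?Pi1 // addrC -scaleNr -[X in _ + X]scale1r.
move=> /(comb2_ge0 Pa Pb ab); rewrite formC; lra.
Qed.

(** If a word makes a positive root negative, then the root becomes the simple
    root of the next letter at some stage. *)
Lemma sign_change t s b : letters Pi t -> letters Pi s -> Pi b ->
  cone Pi (word B s b) -> cone Pi (- word B t (word B s b)) ->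
  exists t1 d t2, t = t1 ++ d :: t2 /\ word B t2 (word B s b) = d.
Proof.
elim: t => [|d t IH] /=.
  by move=> _ sP Pb Cx Nx; case: (root_not_both sP Pb Cx Nx).
move=> /letters_cons[Pd tP] sP Pb Cx Nx.
have [E|dE] := pselect (word B t (word B s b) = d).
  by exists [::], d, t.
have tsP : letters Pi (t ++ s) by exact/letters_cat.
have [|Cy|Ny] := @root_sign (t ++ s) b _ Pb; first exact/letters_cat.
  have := @refl_pos d (t ++ s) b Pd tsP Pb Cy.
  rewrite word_cat => /(_ dE) /= Cz.
  exfalso; apply: (@root_not_both (d :: t ++ s) b _ Pb); rewrite /= ?word_cat //.
    exact/letters_cons.
  by move: Cz; rewrite word_cat.
have [|t1 [e [t2 [-> E]]]] := IH tP sP Pb Cx; first by rewrite -word_cat.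
by exists (d :: t1), e, t2.
Qed.

(** The exchange condition. *)
Lemma exchange t a : letters Pi t -> Pi a -> cone Pi (- word B t a) ->
  exists t1 d t2, t = t1 ++ d :: t2 /\
    word B (rcons t a) = word B (t1 ++ t2).
Proof.
move=> tP Pa Na.
have [|t1 [d [t2 [E /= Ed]]]] := @sign_change t [::] a tP (letters_nil _) Pa _ Na.
  exact: cone_mem.
exists t1, d, t2; split=> //; apply/funext => v.
move: tP; rewrite E => /letters_cat[t1P /letters_cons[Pd t2P]].
rewrite -cats1 -catA /= !word_cat /= -[in LHS]Ed word_cat /=.
by rewrite (refl_word Pi1) ?reflK ?Pi1.
Qed.

(** A vector that is dominant for a set of simple roots decreases under the
    corresponding reflections. *)
Lemma dominant_sub_word K v s : K `<=` Pi -> (forall b, K b -> 0 <= B v b) ->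
  letters K s -> cone Pi (v - word B s v).
Proof.
move=> KP dv; have [n] := ubnP (size s); elim: n s => // n IH s.
case/lastP: s => [|s a]; first by rewrite subrr => _ _; exact: cone0.
rewrite size_rcons ltnS => sn /letters_rcons[sK Ka].
have sP := letters_sub KP sK; have Pa := KP _ Ka.
have [Ca|/(exchange sP Pa)[t1 [d [t2 [E ->]]]]] := root_sign sP Pa; last first.
  apply: IH; first by rewrite (leq_trans _ sn) // E !size_cat /=; lia.
  by move: sK; rewrite E => /letters_cat[? /letters_cons[? ?]]; exact/letters_cat.
rewrite word_rcons reflE ?Pi1 // (wordB Pi1 sP) (wordZ Pi1 sP) opprB addrCA addrC.
apply: coneD; first exact: IH.
by apply: coneZ => //; rewrite mulr_ge0 // dv.
Qed.

(** * The sign of a formal root *)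

(** Two words act in the same way on the formal roots. *)
Definition same s t := forall f a, Pi a -> dual_word B s f a = dual_word B t f a.

Lemma dual_word_eq s f g : letters Pi s -> (forall a, Pi a -> f a = g a) ->
  forall a, Pi a -> dual_word B s f a = dual_word B s g a.
Proof.
move=> + fg; elim: s => [_|b s IH /letters_cons[Pb sP] a Pa] //=.
by rewrite /dual_refl !IH.
Qed.

Lemma same_sym s t : same s t -> same t s.
Proof. by move=> H f a Pa; rewrite H. Qed.

Lemma same_trans s t u : same s t -> same t u -> same s u.
Proof. by move=> st tu f a Pa; rewrite st // tu. Qed.

Lemma same_cat s s' t t' : letters Pi s -> same s s' -> same t t' ->
  same (s ++ t) (s' ++ t').
Proof.
move=> sP ss tt f a Pa; rewrite !dual_word_cat -ss //.
by apply: dual_word_eq => // b Pb; exact: tt.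
Qed.

(** The relation is compatible with inverses, which are reversed words. *)
Lemma same_rev s t : letters Pi s -> letters Pi t -> same s t ->
  same (rev s) (rev t).
Proof.
move=> sP tP st f a Pa.
rewrite -[f in RHS](dual_word_Krev Pi1 _ sP).
rewrite -[LHS](congr1 (@^~ a) (dual_word_revK Pi1 (dual_word B (rev s) f) tP)).
by apply: dual_word_eq => //; [exact/letters_rev|move=> b Pb; rewrite st].
Qed.

Lemma same_lift s t a f : letters Pi s -> letters Pi t -> Pi a -> same s t ->
  lift B s a f = lift B t a f.
Proof. by move=> sP tP Pa st; exact: same_rev. Qed.

(** In rank two, formal roots are given by the coefficients of actual roots. *)
Lemma rank2_lift a b u c : Pi a -> Pi b -> a <> b ->
  letters [set a; b] u -> Pi c ->
  exists p q, word B u c = c + p *: a + q *: b /\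
    forall f, lift B u c f = f c + p * f a + q * f b.
Proof.
move=> Pa Pb ab; elim: u => [|d u IH].
  by exists 0, 0; rewrite !scale0r !addr0; split=> // f; rewrite !mul0r !addr0.
move=> /letters_cons[dab /IH{}IH] Pc; have [p [q [E Ef]]] := IH Pc.
have dP : Pi d by case: dab => ->.
have L f : lift B (d :: u) c f =
    f c + p * f a + q * f b - 2 * B (c + p *: a + q *: b) d * f d.
  by rewrite lift_cons Ef /dual_refl !formDl !formZl; ring.
rewrite [word _ _ _]/= E reflE ?Pi1 //.
set k := 2 * _ in L *.
case: dab L => -> L.
  exists (p - k), q; split; last by move=> f; rewrite L; ring.
  by rewrite scalerBl addrAC addrA.
exists p, (q - k); split; last by move=> f; rewrite L; ring.
by rewrite scalerBl addrA.
Qed.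

(** Hence words in two letters that agree on V agree on formal roots. *)
Lemma rank2_same a b u u' : Pi a -> Pi b -> a <> b ->
  letters [set a; b] u -> letters [set a; b] u' -> word B u = word B u' ->
  same u u'.
Proof.
move=> Pa Pb ab uI u'I E.
have IP : [set a; b] `<=` Pi by move=> x [->|->].
have uP := letters_sub IP uI; have u'P := letters_sub IP u'I.
have Er : word B (rev u) = word B (rev u').
  apply/funext => v; rewrite -{1}[v](word_Krev Pi1 _ u'P) -E.
  by rewrite (word_revK Pi1 uP).
suff : same (rev u) (rev u').
  by move/same_rev; rewrite !revK; apply; exact/letters_rev.
have L c f : Pi c -> lift B u c f = lift B u' c f.
  move=> Pc.
  have [p [q [E1 ->]]] := rank2_lift Pa Pb ab uI Pc.
  have [p' [q' [E2 ->]]] := rank2_lift Pa Pb ab u'I Pc.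
  move: E1; rewrite E E2 -!addrA => /addrI E3.
  have /(comb2_eq0 Pa Pb ab)[]: (p' - p) *: a + (q' - q) *: b = 0.
    by rewrite !scalerBl addrACA -opprD E3 subrr.
  by move=> /subr0_eq -> /subr0_eq ->.
by move=> f c Pc; exact: L.
Qed.

(** Functions that are non-negative on the simple roots. *)
Definition dominant f : Prop := forall a, Pi a -> 0 <= f a.

(** The formal root [s a] is non-negative on all dominant functions, that is,
    its coordinates are non-negative. *)
Definition pos_lift s a : Prop := forall f, dominant f -> 0 <= lift B s a f.

Lemma lift_rcons_self s a f : Pi a -> lift B (rcons s a) a f = - lift B s a f.
Proof.
by move=> Pa; rewrite /lift rev_rcons /= /dual_refl Pi1 //; ring.
Qed.

Lemma same_double s a t : letters Pi s -> Pi a -> letters Pi t ->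
  same (s ++ [:: a, a & t]) (s ++ t).
Proof.
move=> sP Pa tP f b Pb; rewrite !dual_word_cat /=.
by rewrite dual_reflK // Pi1.
Qed.

(** If right multiplication by the reflection in a simple root a does not
    shorten the action of s on formal roots, then the formal root [s a] is
    positive: induction on the length, splitting off a maximal right factor
    in the rank two group generated by a and by the last letter of s. *)
Lemma long_pos_lift s a : letters Pi s -> Pi a ->
  (forall t, letters Pi t -> same t s -> (size s <= size t)%N) ->
  (forall t, letters Pi t -> same t (rcons s a) -> (size s <= size t)%N) ->
  pos_lift s a.
Proof.
have [n] := ubnP (size s); elim: n s a => // n IH s a.
case/lastP: s => [|s b]; first by move=> _ _ Pa _ _ f df; exact: df.
rewrite ltnS => sn /letters_rcons[sP Pb] Pa red reda.
have ab : a <> b.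
  move=> ab; move: reda; rewrite ab => /(_ s sP) H.
  suff : (size (rcons s b) <= size s)%N by rewrite size_rcons ltnn.
  apply: H.
  have := @same_double s b [::] sP Pb (letters_nil _).
  by rewrite cats0 -cat_rcons cats1 => /same_sym.
have IP : [set a; b] `<=` Pi by move=> x [->|->].
set m := size (rcons s b) in sn red reda.
have sbP : letters Pi (rcons s b) by exact/letters_rcons.
(* Among the reduced factorizations of the word as v ++ u, where u has letters
   a and b only and is not empty, take one with v shortest. *)
pose Q k := exists v u, [/\ size v = k, letters Pi v, letters [set a; b] u,
  same (v ++ u) (rcons s b) & (k < m)%N /\ (k + size u)%N = m].
have exQ : exists k, `[< Q k >].
  exists (size s); apply/asboolP; exists s, [:: b]; split=> //.
  - by move=> x; rewrite inE => /eqP->; right.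
  - by rewrite cats1.
  - by rewrite /m size_rcons addn1.
case: (ex_minnP exQ) => k /asboolP[v [u [vk vP uI vu [km uk]]]] kmin.
have uP := letters_sub IP uI.
have vuP : letters Pi (v ++ u) by exact/letters_cat.
have vred t : letters Pi t -> same t v -> (size v <= size t)%N.
  move=> tP tv; have := red (t ++ u); rewrite size_cat => H.
  rewrite vk -(leq_add2r (size u)) uk; apply: H; first exact/letters_cat.
  by apply: same_trans vu; exact: same_cat.
have vredc c t : [set a; b] c -> letters Pi t -> same t (rcons v c) ->
    (size v <= size t)%N.
  move=> Ic tP tv; have Pc := IP _ Ic.
  rewrite leqNgt; apply/negP => tv'.
  have ctP : letters Pi (c :: u) by exact/letters_cons.
  have tcu : same (t ++ c :: u) (rcons s b).
    apply: same_trans vu.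
    apply: same_trans (@same_double v c u vP Pc uP).
    by rewrite -[v ++ _]cat_rcons; exact: same_cat.
  have tcuP : letters Pi (t ++ c :: u) by exact/letters_cat.
  have := red _ tcuP tcu; rewrite size_cat /= => H.
  have /kmin : `[< Q (size t) >].
    apply/asboolP; exists t, (c :: u); split=> //=; first exact/letters_cons.
    by move: H tv' km uk; rewrite vk; lia.
  by rewrite leqNgt -vk tv'.
have pa : pos_lift v a.
  apply: (IH v a) => //; first by rewrite vk (leq_trans km).
  by move=> t; apply: vredc; left.
have pb : pos_lift v b.
  apply: (IH v b) => //; first by rewrite vk (leq_trans km).
  by move=> t; apply: vredc; right.
(* In rank two the sign of a formal root can be read off in V, where the
   exchange condition is available. *)
have Cu : cone Pi (word B u a).
  have [//|/(exchange uP Pa)[t1 [d [t2 [E E']]]]] := root_sign uP Pa.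
  have t12I : letters [set a; b] (t1 ++ t2).
    by move: uI; rewrite E => /letters_cat[? /letters_cons[? ?]]; exact/letters_cat.
  have uaI : letters [set a; b] (rcons u a) by apply/letters_rcons; split=> //; left.
  have S := rank2_same Pa Pb ab uaI t12I E'.
  have /reda : letters Pi (v ++ t1 ++ t2).
    by apply/letters_cat; split=> //; exact: letters_sub IP _.
  suff /[swap]/[apply] : same (v ++ t1 ++ t2) (rcons (rcons s b) a).
    by rewrite -/m -uk E !size_cat /= vk; lia.
  apply: same_trans (same_cat vP (fun _ _ _ => erefl) (same_sym S)) _.
  rewrite -rcons_cat -[rcons (v ++ u) a]cats1 -[rcons (rcons s b) a]cats1.
  exact: same_cat.
have [p [q [E L]]] := rank2_lift Pa Pb ab uI Pa.
have {}E : word B u a = (1 + p) *: a + q *: b by rewrite E scalerDl scale1r.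
move: Cu; rewrite E => Cu.
have p0 := comb2_ge0 Pa Pb ab Cu.
have q0 : 0 <= q by move: Cu; rewrite addrC; exact/comb2_ge0/nesym.
move=> f df; rewrite -(same_lift f vuP sbP Pa vu) lift_cat L.
by have := pa f df; have := pb f df; rewrite /lift; nra.
Qed.

(** Every formal root is positive or negative. *)
Lemma lift_sign s a : letters Pi s -> Pi a ->
  pos_lift s a \/ (forall f, dominant f -> lift B s a f <= 0).
Proof.
have min t : letters Pi t -> exists t', [/\ letters Pi t', same t' t &
    forall u, letters Pi u -> same u t -> (size t' <= size u)%N].
  move=> tP; pose Q k := exists t', [/\ size t' = k, letters Pi t' & same t' t].
  have exQ : exists k, `[< Q k >] by exists (size t); apply/asboolP; exists t.
  case: (ex_minnP exQ) => k /asboolP[t' [<- t'P t't]] kmin; exists t'; split=> //.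
  by move=> u uP ut; apply: kmin; apply/asboolP; exists u.
move=> sP Pa; have saP : letters Pi (rcons s a) by exact/letters_rcons.
have [t [tP ts tmin]] := min _ sP.
have [t' [t'P t's t'min]] := min _ saP.
have rc (x y : seq V) : letters Pi x -> same x y -> same (rcons x a) (rcons y a).
  by move=> xP xy; rewrite -!cats1; exact: same_cat.
have rcK (x : seq V) : letters Pi x -> same (rcons (rcons x a) a) x.
  move=> xP; have := @same_double x a [::] xP Pa (letters_nil _).
  by rewrite cats0 -cat_rcons cats1.
have [le|lt] := leqP (size t) (size t').
  left=> f df; rewrite -(same_lift f tP sP Pa ts); move: f df.
  apply: long_pos_lift => //.
    by move=> u uP ut; apply: tmin => //; exact: same_trans ut ts.
  move=> u uP ut; apply: leq_trans le _; apply: t'min => //.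
  by apply: same_trans ut _; exact: rc.
right=> f df; suff : 0 <= lift B (rcons s a) a f by rewrite lift_rcons_self // oppr_ge0.
rewrite -(same_lift f t'P saP Pa t's); move: f df.
apply: long_pos_lift => //.
  by move=> u uP ut; apply: t'min => //; exact: same_trans ut t's.
move=> u uP ut; apply: leq_trans (ltnW lt) _; apply: tmin => //.
apply: same_trans ut _; apply: same_trans (rc _ _ t'P t's) _; exact: rcK.
Qed.

End Roots.

(** * The dual Tits cone *)

Section Tits.
Variables (R : realType) (V : lmodType R) (B : {symmetric V}) (Pi : set V).
Hypothesis HPi : based_root_system B Pi.
Implicit Types (X J : set V) (x y a b : V) (f g : V -> R) (s t u : seq V).

Let Pi1 := simple_norm HPi.

Lemma dominant_coord a : dominant Pi (@coord R V a).
Proof. by move=> b _; rewrite /coord ler0n. Qed.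

Lemma pos_lift_cone s a : letters Pi s -> Pi a -> pos_lift B Pi s a ->
  cone Pi (word B s a).
Proof.
move=> sP Pa ps; rewrite (word_coord Pi1 (S := undup (a :: s))) ?undup_uniq //.
- rewrite big_seq_cond; apply: cone_sum => b; rewrite mem_undup inE andbT => bs.
  apply: coneZ; first exact/ps/dominant_coord.
  by apply: cone_mem; case/orP: bs => [/eqP->|/sP].
- by move=> b bs; rewrite mem_undup inE bs orbT.
- by rewrite mem_undup mem_head.
Qed.

Lemma neg_lift_cone s a : letters Pi s -> Pi a ->
  (forall f, dominant Pi f -> lift B s a f <= 0) -> cone Pi (- word B s a).
Proof.
move=> sP Pa ps.
have -> : - word B s a = word B (rcons s a) a.
  by rewrite word_rcons refl_self ?Pi1 // (wordN Pi1 sP).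
apply: pos_lift_cone => //; first exact/letters_rcons.
by move=> f df; rewrite (lift_rcons_self HPi) // oppr_ge0 ps.
Qed.

(** The formal root above a positive root is positive. *)
Lemma pos_liftP s a : letters Pi s -> Pi a -> cone Pi (word B s a) ->
  pos_lift B Pi s a.
Proof.
move=> sP Pa Cx; have [//|ns] := lift_sign HPi sP Pa.
by case: (root_not_both HPi sP Pa Cx); exact: neg_lift_cone.
Qed.

(** The formal root above a simple root b is b itself: its coordinates are
    non-negative and b spans an extreme ray. *)
Lemma lift_simple s a b f : letters Pi s -> Pi a -> Pi b -> word B s a = b ->
  lift B s a f = f b.
Proof.
move=> sP Pa Pb E; pose S := undup [:: b, a & s].
have SP c : c \in S -> Pi c.
  by rewrite mem_undup !inE => /or3P[/eqP->|/eqP->|/sP].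
have uS : uniq S by exact: undup_uniq.
have sS : {subset s <= S} by move=> c cs; rewrite mem_undup !inE cs !orbT.
have aS : a \in S by rewrite mem_undup !inE eqxx orbT.
have bS : b \in S by rewrite mem_undup mem_head.
have ps : pos_lift B Pi s a by apply: pos_liftP => //; rewrite E; exact: cone_mem.
have x0 c : 0 <= lift B s a (coord c) by exact/ps/dominant_coord.
have Eb := word_coord Pi1 uS sP sS aS.
have xc c : c \in S -> c != b -> lift B s a (coord c) = 0.
  move=> cS cb; have Pc := SP _ cS.
  have [|||k k0 Ek] := @simple_extreme _ _ _ _ HPi b 1 (lift B s a (coord c) *: c)
      (\sum_(d <- S | d != c) lift B s a (coord d) *: d) Pb.
  - by apply: coneZ => //; exact: cone_mem.
  - rewrite big_seq_cond; apply: cone_sum => d /andP[/SP Pd _].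
    by apply: coneZ => //; exact: cone_mem.
  - by rewrite scale1r [RHS](eq_trans (esym E) Eb) [RHS](bigD1_seq c).
  have [] // := @comb2_eq0 _ _ _ _ HPi c b (lift B s a (coord c)) (- k) Pc Pb.
    by apply/eqP.
  by rewrite Ek scaleNr subrr.
have xb : lift B s a (coord b) = 1.
  move: Eb; rewrite (bigD1_seq b) //= big_seq_cond big1 ?addr0 => [Eb|c]; last first.
    by move=> /andP[cS cb]; rewrite xc // scale0r.
  by have := congr1 (B b) Eb; rewrite E formZr Pi1 // mulr1.
rewrite (lift_coord B f uS sP sS aS) (bigD1_seq b) //= xb mul1r big_seq_cond.
by rewrite big1 ?addr0 // => c /andP[cS cb]; rewrite xc // mul0r.
Qed.

(** A root determines the formal root above it. *)
Lemma lift_unique s a s' a' f : letters Pi s -> Pi a -> letters Pi s' -> Pi a' ->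
  word B s a = word B s' a' -> lift B s a f = lift B s' a' f.
Proof.
move=> sP Pa s'P Pa' E; pose f' := dual_word B (rev s') f.
have <- : lift B (rev s' ++ s) a f' = lift B s a f.
  by rewrite lift_cat revK (dual_word_Krev Pi1).
rewrite (@lift_simple _ _ a') //.
  by apply/letters_cat; split=> //; exact/letters_rev.
by rewrite word_cat E (word_revK Pi1).
Qed.

(** Words that agree on V agree on formal roots, so that W acts on these. *)
Lemma word_same s t : letters Pi s -> letters Pi t -> word B s = word B t ->
  same B Pi s t.
Proof.
move=> sP tP E f a Pa.
have := @lift_unique (rev s) a (rev t) a f; rewrite /lift !revK; apply=> //.
- exact/letters_rev.
- exact/letters_rev.
- by rewrite -{1}[a](word_Krev Pi1 _ tP) -E (word_revK Pi1).
Qed.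

(** The dual Tits cone: the union of the images of the cone of dominant
    functions under the Coxeter group. *)
Definition tits f : Prop :=
  exists2 s, letters Pi s & dominant Pi (dual_word B s f).

Lemma tits_dual s f : letters Pi s -> tits f -> tits (dual_word B s f).
Proof.
move=> sP [t tP df]; exists (t ++ rev s).
  by apply/letters_cat; split=> //; exact/letters_rev.
by rewrite dual_word_cat (dual_word_revK Pi1).
Qed.

(** The list L contains all positive roots that are negative at f. *)
Definition neg_roots_in f (L : seq V) : Prop :=
  forall s a, letters Pi s -> Pi a -> cone Pi (word B s a) ->
    lift B s a f < 0 -> word B s a \in L.

Lemma neg_roots_refl b f L : Pi b -> neg_roots_in f L ->
  neg_roots_in (dual_refl B b f) (b :: map (refl B b) L).
Proof.
move=> Pb HL s a sP Pa Cx; rewrite -lift_cons => lt0.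
have [->|xb] := pselect (word B s a = b); first exact: mem_head.
rewrite inE; apply/orP; right; apply/mapP; exists (word B (b :: s) a).
  by apply: HL => //; [exact/letters_cons|exact: refl_pos].
by rewrite /= reflK // Pi1.
Qed.

Lemma tits_neg_finite f : tits f -> exists L, neg_roots_in f L.
Proof.
case=> t tP df; rewrite -(dual_word_revK Pi1 f tP).
move: (dual_word B t f) df (rev t) (iffRL (letters_rev _ _) tP) => g dg.
elim=> [_|b u IH /letters_cons[Pb uP]] /=.
  by exists [::] => s a sP Pa Cx; rewrite ltNge (pos_liftP sP Pa Cx dg).
by have [L HL] := IH uP; eexists; exact: (neg_roots_refl Pb HL).
Qed.

(** A function with finitely many negative positive roots is in the dual Tits
    cone: a simple reflection in a negative simple root makes that number
    smaller. *)
Lemma neg_finite_tits f L : neg_roots_in f L -> tits f.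
Proof.
have [n] := ubnP (size L); elim: n L f => // n IH L f Ln HL.
have [df|] := pselect (dominant Pi f); first by exists [::].
move=> /existsNP[b /not_implyP[Pb /negP]]; rewrite -ltNge => fb.
have bL : b \in L by apply: (HL [::] b) => //=; exact: cone_mem.
suff : tits (dual_refl B b f).
  have bP : letters Pi [:: b] by move=> c; rewrite inE => /eqP->.
  by move/(tits_dual bP) => /=; rewrite dual_reflK // Pi1.
apply: (IH (map (refl B b) [seq c <- L | c != b])).
  rewrite size_map size_filter; move: Ln; rewrite ltnS; apply: leq_trans.
  by rewrite -(count_predC (predC1 b)) -addn1 leq_add2l -has_count; apply/hasP;
    exists b => //=; rewrite negbK.
move=> s a sP Pa Cx; rewrite -lift_cons => lt0.
have xb : word B s a <> b.
  move=> xb; move: lt0; rewrite lift_cons (lift_simple _ sP Pa Pb xb).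
  by rewrite /dual_refl Pi1 //; lra.
have bsP : letters Pi (b :: s) by exact/letters_cons.
have Cy : cone Pi (word B (b :: s) a) by exact: refl_pos.
apply/mapP; exists (word B (b :: s) a); last by rewrite /= reflK // Pi1.
rewrite mem_filter HL // andbT; apply/eqP => E.
apply: (root_not_both HPi sP Pa Cx).
rewrite -[word B s a](reflK (Pi1 Pb)) -[refl B b (word B s a)]/(word B (b :: s) a) E.
by rewrite refl_self ?Pi1 // opprK; exact: cone_mem.
Qed.

Lemma titsD f g : tits f -> tits g -> tits (fun v => f v + g v).
Proof.
move=> /tits_neg_finite[L HL] /tits_neg_finite[M HM].
apply: (@neg_finite_tits _ (L ++ M)) => s a sP Pa Cx.
rewrite liftD mem_cat => lt0.
have [f0|f0] := ltP (lift B s a f) 0; first by rewrite HL.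
by rewrite HM ?orbT //; lra.
Qed.

Lemma tits_sum (I : eqType) (r : seq I) (F : I -> V -> R) :
  (forall i, i \in r -> tits (F i)) -> tits (fun v => \sum_(i <- r) F i v).
Proof.
elim: r => [|i r IH] H; first by exists [::] => // a _ /=; rewrite big_nil.
rewrite (_ : (fun v => _) = fun v => F i v + \sum_(j <- r) F j v).
  apply: titsD; first exact/H/mem_head.
  by apply: IH => j jr; apply: H; rewrite inE jr orbT.
by apply/funext => v; rewrite big_cons.
Qed.

(** An element of the dual Tits cone that vanishes on a set J of simple roots
    is made dominant by an element mapping J to a set of simple roots: the
    elements of least length do this. *)
Lemma tits_vanish J f : J `<=` Pi -> tits f -> (forall b, J b -> f b = 0) ->
  exists d, [/\ letters Pi d, dominant Pi (dual_word B d f) &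
    forall b, J b -> Pi (word B d b)].
Proof.
move=> JP tf fJ.
pose Q k := exists d, [/\ size d = k, letters Pi d & dominant Pi (dual_word B d f)].
have exQ : exists k, `[< Q k >].
  by case: tf => d dP df; exists (size d); apply/asboolP; exists d.
case: (ex_minnP exQ) => k /asboolP[d [dk dP df]] kmin.
have {kmin} dmin d' : letters Pi d' -> (size d' < size d)%N ->
    (forall a, Pi a -> dual_word B d' f a = dual_word B d f a) -> False.
  move=> d'P lt E; have /kmin : `[< Q (size d') >].
    by apply/asboolP; exists d'; split=> // a Pa; rewrite E // df.
  by rewrite leqNgt -dk lt.
exists d; split=> // b Jb; have Pb := JP _ Jb.
(* The reflection in b fixes f, so that it cannot shorten d. *)
have Cdb : cone Pi (word B d b).
  have [//|/(exchange HPi dP Pb)[t1 [c [t2 [E E']]]]] := root_sign HPi dP Pb.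
  exfalso; have [t1P /letters_cons[_ t2P]] : letters Pi t1 /\ letters Pi (c :: t2).
    by apply/letters_cat; rewrite -E.
  have t12P : letters Pi (t1 ++ t2) by exact/letters_cat.
  apply: (dmin (t1 ++ t2)) => // [|a Pa]; first by rewrite E !size_cat /=; lia.
  have dbP : letters Pi (rcons d b) by exact/letters_rcons.
  rewrite -(word_same dbP t12P E' f Pa) dual_word_rcons.
  congr (dual_word B d _ a); apply/funext => v.
  by rewrite /dual_refl (fJ b Jb) mulr0 subr0.
(* Likewise for the simple reflections that fix the image of f under d. *)
have wall c : Pi c -> dual_word B d f c = 0 -> cone Pi (word B (rev d) c).
  move=> Pc fc; have rdP : letters Pi (rev d) by exact/letters_rev.
  have [//|/(exchange HPi rdP Pc)[t1 [e [t2 [E E']]]]] := root_sign HPi rdP Pc.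
  exfalso; have [t1P /letters_cons[_ t2P]] : letters Pi t1 /\ letters Pi (e :: t2).
    by apply/letters_cat; rewrite -E.
  have t12P : letters Pi (t1 ++ t2) by exact/letters_cat.
  have dcP : letters Pi (rcons (rev d) c) by exact/letters_rcons.
  apply: (dmin (rev (t1 ++ t2))) => [||a Pa]; first exact/letters_rev.
    by rewrite -[d]revK E !size_rev !size_cat /=; lia.
  have := same_rev HPi dcP t12P (word_same dcP t12P E') f Pa.
  rewrite rev_rcons revK /= /dual_refl fc mulr0 subr0 => ->.
  by [].
pose S := undup (b :: d).
have SP c : c \in S -> Pi c by rewrite mem_undup inE => /orP[/eqP->|/dP].
have uS : uniq S by exact: undup_uniq.
have dS : {subset d <= S} by move=> c cs; rewrite mem_undup inE cs orbT.
have bS : b \in S by rewrite mem_undup mem_head.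
set x := fun c => lift B d b (coord c).
have x0 c : 0 <= x c by exact: (pos_liftP dP Pb Cdb (dominant_coord c)).
have Eb : word B d b = \sum_(c <- S) x c *: c by exact: (word_coord Pi1).
have xw c : c \in S -> x c * dual_word B d f c = 0.
  have : lift B d b (dual_word B d f) = 0.
    by rewrite /lift (dual_word_revK Pi1) // fJ.
  rewrite (lift_coord B _ uS dP dS bS) => /eqP.
  rewrite big_seq_cond psumr_eq0; last first.
    by move=> e /andP[/SP Pe _]; apply: mulr_ge0; [exact: x0|exact: df].
  by move=> /allP H cS; have := H c cS; rewrite cS /= => /eqP.
(* Pulling [d b] back, b becomes a sum of vectors of the cone, all of which
   are multiples of b since b spans an extreme ray. *)
have Cx c : c \in S -> cone Pi (x c *: word B (rev d) c).
  move=> cS; have /eqP := xw _ cS; rewrite mulf_eq0 => /orP[/eqP->|/eqP fc].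
    by rewrite scale0r; exact: cone0.
  by apply: coneZ => //; apply: wall => //; exact: SP.
have [c cS xc] : exists2 c, c \in S & x c != 0.
  apply: contrapT => /forall2NP H; apply: (unit_neq0 (word_norm HPi dP Pb)).
  rewrite Eb big_seq big1 // => c cS; have [//|/negP/negPn/eqP->] := H c.
  by rewrite scale0r.
have {}xc : 0 < x c by rewrite lt_neqAle eq_sym xc x0.
have Pc := SP _ cS; have rdP : letters Pi (rev d) by exact/letters_rev.
have [|||l l0 El] := @simple_extreme _ _ _ _ HPi b 1 (x c *: word B (rev d) c)
    (\sum_(e <- S | e != c) x e *: word B (rev d) e) Pb.
- exact: Cx.
- by rewrite big_seq_cond; apply: cone_sum => e /andP[/Cx].
- rewrite scale1r -[RHS](word_revK Pi1 dP b) Eb (word_sum Pi1 rdP).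
  rewrite [RHS](bigD1_seq c) //= (wordZ Pi1 rdP); congr (_ + _).
  by apply: eq_bigr => e _; rewrite (wordZ Pi1 rdP).
suff -> : word B d b = c by [].
suff <- : word B (rev d) c = b by rewrite (word_Krev Pi1).
apply: (@simple_extreme_root _ _ _ _ HPi b (l / x c) (rev d) c 0) => //.
- have fc : dual_word B d f c = 0.
    by apply/eqP; have /eqP := xw _ cS; rewrite mulf_eq0 gt_eqF.
  exact: wall.
- exact: cone0.
- by rewrite addr0 mulrC -scalerA -El scalerA mulVf ?scale1r // gt_eqF.
Qed.

End Tits.

(** * Averaging over finite parabolic subgroups *)

Section Averaging.
Variables (R : realType) (V : lmodType R) (B : {symmetric V}) (Pi : set V).
Hypothesis HPi : based_root_system B Pi.
Implicit Types (X J K D : set V) (x a b : V) (f g : V -> R) (s t u : seq V).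

Let Pi1 := simple_norm HPi.

Lemma refl_inj a b : Pi a -> Pi b -> refl B a = refl B b -> a = b.
Proof.
move=> Pa Pb E; apply: contrapT => ab.
have /(comb2_eq0 HPi Pa Pb ab)[] : (-2) *: a + (2 * B a b) *: b = 0.
  have H : - a = a - (2 * B a b) *: b.
    by rewrite -(reflE (Pi1 Pb)) -E refl_self ?Pi1.
  have -> : (2 * B a b) *: b = a + a.
    by rewrite -[X in a + X]opprK H opprB addrCA subrr addr0.
  by rewrite scaleNr scaler_nat mulr2n addNr.
by move=> /eqP; rewrite oppr_eq0 pnatr_eq0.
Qed.

(** If the product of two distinct simple reflections has order at most 2,
    then the roots are orthogonal. *)
Lemma unjoined_orth a b : Pi a -> Pi b -> a <> b -> ~ joined B a b -> B a b = 0.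
Proof.
move=> Pa Pb ab nj; have [n nE] : exists n : nat, (0 < n < 3)%N /\
    iter n (refl B a \o refl B b) = id.
  apply: contrapT => /forallNP H; apply: nj; split=> // n n03 E.
  by apply: (H n).
have ra c d : refl B a (c *: a + d *: b) = (- c - 2 * d * B a b) *: a + d *: b.
  rewrite reflE ?Pi1 // formDl !formZl (Pi1 Pa) (formC B b a).
  rewrite addrAC -scalerBl; congr (_ *: _ + _); ring.
have rb c d : refl B b (c *: a + d *: b) = c *: a + (- d - 2 * c * B a b) *: b.
  rewrite reflE ?Pi1 // formDl !formZl (Pi1 Pb).
  rewrite -addrA -scalerBl; congr (_ + _ *: _); ring.
have rbb : refl B b b = 0 *: a + (- 1) *: b.
  by rewrite refl_self ?Pi1 // scale0r add0r scaleN1r.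
have Eb : b = 0 *: a + 1 *: b by rewrite scale0r add0r scale1r.
have inj p q : p *: a + q *: b = b -> q = 1.
  rewrite [RHS]Eb => /eqP; rewrite eq_sym -subr_eq0 opprD addrACA -!scalerBl.
  by move=> /eqP/(comb2_eq0 HPi Pa Pb ab)[_ /subr0_eq].
case: nE => + /(congr1 (@^~ b)); case: n => [|[|[|n]]] //= _; rewrite rbb ra.
  move=> /inj; lra.
rewrite rb ra => /inj E.
apply/eqP; rewrite -sqrf_eq0; apply/eqP; move: E; nra.
Qed.

Lemma parabolic_sub J K : J `<=` K -> K `<=` Pi ->
  parabolic B J `<=` parabolic B K.
Proof.
move=> JK KP w /(parabolicP HPi w (subset_trans JK KP))[s sJ ->].
by apply/(parabolicP HPi _ KP); exists s => //; exact: letters_sub JK sJ.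
Qed.

Lemma finite_parabolic_finite J : J `<=` Pi -> finite_set (parabolic B J) ->
  finite_set J.
Proof.
move=> JP fJ.
pose root w := xget 0 [set a | J a /\ w = refl B a].
apply: (sub_finite_set _ (finite_image root fJ)) => a Ja.
exists (refl B a).
  by move=> A [_]; apply; exists a.
rewrite /root; case: xgetP => [b _ [Jb E]|/(_ a)[]//].
by apply: refl_inj; rewrite ?E //; exact: JP.
Qed.

(** Averaging a function over Y makes it vanish on D. *)
Definition kills D (Y : seq (seq V)) : Prop :=
  forall f b, D b -> \sum_(y <- Y) dual_word B y f b = 0.

(** Summing over a finite parabolic subgroup gives an invariant function, and
    an invariant function vanishes on the simple roots of the subgroup. *)
Lemma finite_parabolic_kills D : D `<=` Pi -> finite_set (parabolic B D) ->
  exists Y, [/\ (0 < size Y)%N, forall y, y \in Y -> letters D y & kills D Y].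
Proof.
move=> DP /finite_seqP[L0 EL]; pose L := undup L0.
have LP w : w \in L <-> parabolic B D w by rewrite EL mem_undup.
have [wd Hwd] : {wd : (V -> V) -> seq V &
    forall w, w \in L -> letters D (wd w) /\ w = word B (wd w)}.
  apply: (choice (P := fun w s => w \in L -> letters D s /\ w = word B s)) => w.
  have [/LP/(parabolicP HPi _ DP)[s sD E]|//] := boolP (w \in L).
    by exists s.
  by exists [::].
exists (map wd L); split.
- rewrite size_map; have /LP : parabolic B D id by apply/(parabolicP HPi _ DP); exists [::].
  by rewrite lt0n size_eq0; apply: contraTneq => ->.
- by move=> y /mapP[w wL ->]; have [] := Hwd w wL.
move=> f b Db; have Pb := DP _ Db; rewrite big_map.
pose A v := \sum_(w <- L) dual_word B (wd w) f v.
suff : dual_refl B b A b = A b by rewrite /dual_refl Pi1 // -/(A b); lra.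
have LPi w : w \in L -> letters Pi (wd w).
  by move=> /Hwd[wD _]; exact: letters_sub DP wD.
have mulL w : w \in L -> (refl B b \o w) \in L.
  move=> wL; have [wD E] := Hwd _ wL; apply/LP/(parabolicP HPi _ DP).
  by exists (b :: wd w); [exact/letters_cons|rewrite {1}E].
have pL : perm_eq [seq refl B b \o w | w <- L] L.
  apply: uniq_perm; [|exact: undup_uniq|].
    rewrite map_inj_uniq ?undup_uniq // => w w' /(congr1 (fun h => refl B b \o h)).
    move=> E; apply/funext => v; have := congr1 (@^~ v) E.
    by rewrite /= !reflK ?Pi1.
  move=> w; apply/mapP/idP => [[w' w'L ->]|wL]; first exact: mulL.
  exists (refl B b \o w); first exact: mulL.
  by apply/funext => v; rewrite /= reflK ?Pi1.
rewrite /A -[in RHS](perm_big _ pL) big_map /=.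
transitivity (\sum_(w <- L) dual_word B (b :: wd w) f b).
  rewrite /= /dual_refl mulr_sumr -sumrB; apply: eq_bigr => w _; ring.
rewrite big_seq [RHS]big_seq; apply: eq_bigr => w wL.
apply: (word_same HPi) => //; first by apply/letters_cons; split=> //; exact: LPi.
  exact/LPi/mulL.
have [_ <-] := Hwd _ (mulL w wL); have [_ E] := Hwd _ wL.
by apply/funext => v /=; rewrite {2}E.
Qed.

(** Elements of J lie in subsets of J that generate a finite group and are
    orthogonal to the rest of J. *)
Lemma component_closed J b : J `<=` Pi -> J = Jfin B J -> J b ->
  exists C, [/\ C `<=` J, C b, finite_set (parabolic B C) &
    forall x (y : V), C x -> J y -> ~ C y -> B x y = 0].
Proof.
move=> JP EJ; rewrite {1}EJ => -[C [[a Ja <-] fC] Cb].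
exists (component B J a); split=> //; first by move=> x [].
move=> x y [Jx ax] Jy nCy; apply: unjoined_orth; try exact: JP.
  by move=> xy; apply: nCy; rewrite -xy; split.
move=> jxy; apply: nCy; split=> //; apply: Relation_Operators.rt_trans ax _.
exact: Relation_Operators.rt_step.
Qed.

(** A finite subset of J lies in a finite union D of components of J, over
    which there is an averaging family of words; this family can be chosen
    stable under reversal of words. *)
Lemma finite_block J (L : seq V) : J `<=` Pi -> J = Jfin B J -> letters J L ->
  exists (D : seq V) (Y : seq (seq V)),
    [/\ letters J D, {subset L <= D},
        forall x (y : V), x \in D -> J y -> y \notin D -> B x y = 0 &
        [/\ (0 < size Y)%N, forall y, y \in Y -> letters [set` D] y,
            kills [set` D] Y &
            forall h : seq V -> R, \sum_(y <- Y) h (rev y) = \sum_(y <- Y) h y]].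
Proof.
move=> JP EJ LJ.
suff [D [Y [DJ LD Dorth [Y0 YD kY]]]] : exists (D : seq V) (Y : seq (seq V)),
    [/\ letters J D, {subset L <= D},
        forall x (y : V), x \in D -> J y -> y \notin D -> B x y = 0 &
        [/\ (0 < size Y)%N, forall y, y \in Y -> letters [set` D] y &
            kills [set` D] Y]].
  (* The words y ++ rev y' form a family stable under reversal. *)
  exists D, [seq y ++ rev y' | y <- Y, y' <- Y]; split=> //; split.
  - by rewrite size_allpairs muln_gt0 Y0.
  - move=> _ /allpairsP[[y y'] [/= /YD yD /YD y'D ->]].
    by apply/letters_cat; split=> //; exact/letters_rev.
  - move=> f b Db; rewrite big_allpairs_dep exchange_big /= big1 // => y' _.
    under eq_bigr do rewrite dual_word_cat; exact: kY.
  - move=> h; rewrite !big_allpairs_dep exchange_big /=.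
    by apply: eq_bigr => y _; apply: eq_bigr => y' _; rewrite rev_cat revK.
elim: L LJ => [_|b L IH /letters_cons[Jb /IH{IH}[D [Y [DJ LD Dorth [Y0 YD kY]]]]]].
  exists [::], [:: [::]]; split=> //; split=> //.
  by move=> y; rewrite inE => /eqP->.
have [bD|bD] := boolP (b \in D).
  exists D, Y; split=> // x; rewrite inE => /orP[/eqP->//|]; exact: LD.
have [C [CJ Cb fC Corth]] := component_closed JP EJ Jb.
pose C' := C `\` [set` D].
have C'J : C' `<=` J by move=> x [/CJ].
have C'P := subset_trans C'J JP.
have fC' : finite_set (parabolic B C').
  by apply: sub_finite_set fC; apply: parabolic_sub; [move=> x []|exact: subset_trans JP].
have /finite_seqP[E EE] := finite_parabolic_finite C'P fC'.
have EP x : (x \in E) <-> C' x by rewrite EE.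
have [Z [Z0 ZC kZ]] := finite_parabolic_kills C'P fC'.
have C'D x y : C' x -> y \in D -> B x y = 0.
  by move=> [/CJ Jx /negP xD] yD; rewrite formC Dorth.
exists (D ++ E), [seq y ++ z | y <- Y, z <- Z]; split.
- by apply/letters_cat; split=> // x /EP[/CJ].
- move=> x; rewrite inE mem_cat => /orP[/eqP->|/LD->//].
  by apply/orP; right; apply/EP; split=> //; exact/negP.
- move=> x y; rewrite !mem_cat negb_or => xDE Jy /andP[yD yE].
  case/orP: xDE => [xD|/EP[Cx _]]; first exact: Dorth.
  apply: Corth => // Cy; move/negP: yE; apply; apply/EP; split=> //; exact/negP.
split.
- by rewrite size_allpairs muln_gt0 Y0.
- move=> _ /allpairsP[[y z] [/= /YD yD /ZC zC ->]]; apply/letters_cat; split.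
    by move=> x /yD /= xD; rewrite /= mem_cat xD.
  by move=> x /zC /EP xE; rewrite /= mem_cat xE orbT.
move=> f c; rewrite big_allpairs_dep /= => cDE.
transitivity (\sum_(y <- Y) dual_word B y (fun v => \sum_(z <- Z) dual_word B z f v) c).
  apply: eq_bigr => y _; rewrite dual_word_sum.
  by apply: eq_bigr => z _; rewrite dual_word_cat.
move: cDE; rewrite mem_cat => /orP[cD|/EP cC]; first exact: kY.
rewrite big_seq big1 // => y /YD yD; rewrite dual_word_orth; first exact: kZ.
by move=> a /yD; exact: C'D.
Qed.

End Averaging.

(** * Orthogonal projections *)

Section Projection.
Variables (R : realType) (V : lmodType R) (B : {symmetric V}) (Pi : set V).
Hypothesis HPi : based_root_system B Pi.
Variable J : set V.
Hypothesis JPi : J `<=` Pi.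
Hypothesis JJ : J = Jfin B J.
Hypothesis Jsum : direct_sum (lspan J) (perp B J).
Implicit Types (u v x a b : V) (y : seq V).

Let Pi1 := simple_norm HPi.

Lemma lspan_perp0 v : lspan J v -> perp B J v -> v = 0.
Proof.
by case: Jsum => _ E Lv Pv; suff : [set 0] v by []; rewrite -E; split.
Qed.

Lemma proj_spec v : perp B J (proj B J v) /\ lspan J (v - proj B J v).
Proof.
rewrite /proj; case: xgetP => [u _ []//|/(_ _)H].
case: Jsum => /(_ v)[x Lx [y Py E]] _; case: (H y).
by split=> //; rewrite E addrK.
Qed.

Lemma proj_uniq v u : perp B J u -> lspan J (v - u) -> proj B J v = u.
Proof.
move=> Pu Lu; have [Pp Lp] := proj_spec v.
apply/eqP; rewrite -subr_eq0; apply/eqP; apply: lspan_perp0; last exact/perpD/perpN.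
rewrite (_ : _ - u = (v - u) - (v - proj B J v)); first exact/lspanD/lspanN.
by rewrite opprB [RHS]addrC addrA subrK.
Qed.

Lemma proj_id v : perp B J v -> proj B J v = v.
Proof. by move=> Pv; apply: proj_uniq => //; rewrite subrr; exact: lspan0. Qed.

Lemma proj_lspan v : lspan J v -> proj B J v = 0.
Proof.
move=> Lv; apply: proj_uniq; last by rewrite subr0.
by move=> x _; rewrite form0l.
Qed.

Lemma projD u v : proj B J (u + v) = proj B J u + proj B J v.
Proof.
have [Pu Lu] := proj_spec u; have [Pv Lv] := proj_spec v.
by apply: proj_uniq; [exact: perpD|rewrite opprD addrACA; exact: lspanD].
Qed.

Lemma projZ (c : R) v : proj B J (c *: v) = c *: proj B J v.
Proof.
have [Pv Lv] := proj_spec v.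
by apply: proj_uniq; [exact: perpZ|rewrite -scalerBr; exact: lspanZ].
Qed.

Lemma form_proj v x : perp B J v -> B v (proj B J x) = B v x.
Proof.
move=> Pv; have [_ Lx] := proj_spec x.
by rewrite -[x in RHS](subrK (proj B J x)) formDr (perp_lspan Pv Lx) add0r.
Qed.

Lemma proj_cone x : cone Pi x -> cone (Delta B Pi J) (proj B J x).
Proof.
move: x; apply: cone_ind.
- by rewrite proj_lspan; [exact: cone0|exact: lspan0].
- by move=> u v Cu Cv; rewrite projD; exact: coneD.
- move=> c v c0 Pv; rewrite projZ; apply: coneZ => //.
  have [Jv|nJv] := pselect (J v).
    by rewrite proj_lspan; [exact: cone0|exact: lspan_mem].
  by apply: cone_mem; exists v.
Qed.

(** The orthogonal projection of a simple root outside J is a non-negative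
    combination of simple roots, because vectors of the span of J that are
    dominant for J are such combinations: their average over a
    finite parabolic subgroup is 0. *)
Lemma proj_simple_cone a : Pi a -> ~ J a -> cone Pi (proj B J a).
Proof.
move=> Pa nJa; have [Pp Lp] := proj_spec a.
set p := proj B J a in Pp Lp *; pose v := p - a.
have pE : p = a + v by rewrite addrC subrK.
have Lv : lspan J v by rewrite /v -opprB; exact: lspanN.
suff Cv : cone Pi v by rewrite pE; apply: coneD => //; exact: cone_mem.
have dv b : J b -> 0 <= B v b.
  move=> Jb; rewrite formBl Pp // sub0r oppr_ge0.
  by apply: (simple_form_le0 HPi) => //; [exact: JPi|move=> ab; apply: nJa; rewrite ab].
have [n [c [x [Jx vE]]]] := Lv.
have [|D [Y [DJ xD Dorth [Y0 YD kY _]]]] := @finite_block _ _ _ _ HPi J [seq x i | i <- enum 'I_n] JPi JJ.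
  by move=> _ /mapP[i _ ->].
have YJ y : y \in Y -> letters J y by move=> /YD; exact: letters_sub.
have YP y : y \in Y -> letters Pi y by move=> /YJ; exact: letters_sub.
have s0 : \sum_(y <- Y) word B y v = 0.
  apply: lspan_perp0.
    rewrite big_seq; apply: lspan_sum => y yY.
    rewrite -[word B y v](subrK v); apply: lspanD => //.
    by apply: (word_lspan Pi1 (YP y yY)); exact: YJ.
  move=> b Jb; rewrite form_suml.
  rewrite -[RHS](_ : \sum_(y <- Y) dual_word B y (B v) b = 0).
    by rewrite big_seq [RHS]big_seq; apply: eq_bigr => y yY; rewrite (dual_word_form Pi1 _ (YP y yY)).
  have [bD|bD] := boolP (b \in D); first exact: kY.
  rewrite big_seq big1 // => y yY; rewrite dual_word_orth.
    rewrite vE form_suml big1 // => i _; rewrite formZl Dorth ?mulr0 //.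
    by apply: xD; apply/mapP; exists i; rewrite ?mem_enum.
  by move=> d /(YD y yY) dD; rewrite formC Dorth.
have -> : v = (size Y)%:R^-1 *: \sum_(y <- Y) (v - word B y v).
  rewrite sumrB s0 subr0 big_const_seq count_predT iter_addr_0 -scaler_nat scalerA.
  by rewrite mulVf ?scale1r // pnatr_eq0 -lt0n.
apply: coneZ; first by rewrite invr_ge0 ler0n.
rewrite big_seq; apply: cone_sum => y yY.
exact: (dominant_sub_word HPi JPi dv (YJ y yY)).
Qed.

Lemma cone_Delta x : cone (Delta B Pi J) x -> cone Pi x.
Proof. by apply: cone_sub => _ [a [Pa nJa] <-]; exact: proj_simple_cone. Qed.

Lemma perp_cone_Delta x : cone (Delta B Pi J) x -> perp B J x.
Proof.
move: x; apply: cone_ind.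
- by move=> b _; rewrite form0l.
- by move=> u v; exact: perpD.
- by move=> c _ _ [a _ <-]; apply: perpZ; have [] := proj_spec a.
Qed.

(** The cone spanned by the projections of the simple roots is the part of the
    cone spanned by the simple roots that is orthogonal to J. *)
Lemma cone_DeltaP x : cone (Delta B Pi J) x <-> perp B J x /\ cone Pi x.
Proof.
split=> [Cx|[Px Cx]]; first by split; [exact: perp_cone_Delta|exact: cone_Delta].
by rewrite -(proj_id Px); exact: proj_cone.
Qed.

(** The chamber of J consists of the dominant vectors orthogonal to J. *)
Lemma cCP v : cC B Pi J v <-> perp B J v /\ dominant Pi (B v).
Proof.
split=> [[Pv H]|[Pv dv]]; split=> //.
  move=> a Pa; have [Ja|nJa] := pselect (J a); first by rewrite Pv.
  by rewrite -form_proj //; apply: H; exists a.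
by move=> _ [a [Pa _] <-]; rewrite form_proj //; exact: dv.
Qed.

End Projection.

(** * The cones attached to the objects of the groupoid *)

Section Groupoid.
Variables (R : realType) (V : lmodType R) (B : {symmetric V}) (Pi : set V).
Variable ob : set (set V).
Hypothesis HPi : based_root_system B Pi.
Hypothesis Hob : bh_groupoid B Pi ob.
Hypothesis Hadm : forall K, ob K -> admissible B Pi K.
Implicit Types (J K L : set V) (u v x a b : V) (s d : seq V) (w : V -> V).

Let Pi1 := simple_norm HPi.

Lemma ob_simple J : ob J -> J `<=` Pi.
Proof. by case: Hob => A AP -> [K _ [w [JP _ _ _]]]. Qed.

Lemma ob_fin J : ob J -> J = Jfin B J.
Proof. by case/Hadm. Qed.

Lemma ob_sum J : ob J -> direct_sum (lspan J) (perp B J).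
Proof. by case/Hadm. Qed.

Lemma word_W s : letters Pi s -> W B Pi (word B s).
Proof. by move=> sP; apply/(parabolicP HPi) => //; exists s. Qed.

Lemma hom_word K w J : hom B Pi ob K w J -> exists2 s, letters Pi s & w = word B s.
Proof. by case=> _ _ [_ _ /(parabolicP HPi)H _]; exact: H. Qed.

(** An element mapping the object J into Pi is a morphism of the groupoid. *)
Lemma ob_image J s : ob J -> letters Pi s -> (forall b, J b -> Pi (word B s b)) ->
  hom B Pi ob (word B s @` J) (word B s) J.
Proof.
move=> oJ sP Js; have JP := ob_simple oJ.
have KP : word B s @` J `<=` Pi by move=> _ [b Jb <-]; exact: Js.
split=> //; last by split=> //; exact: word_W.
case: Hob oJ => A AP -> [K AK [w [_ KPi Ww wK]]]; exists K => //.
have /(parabolicP HPi)[//|t tP wt] := Ww.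
exists (word B s \o w); split=> //; last by rewrite -image_comp wK.
by rewrite wt; apply/(parabolicP HPi) => //; exists (s ++ t);
  [exact/letters_cat|apply/funext => v; rewrite word_cat].
Qed.

Lemma hom_sym J s K : letters Pi s -> hom B Pi ob J (word B s) K ->
  hom B Pi ob K (word B (rev s)) J.
Proof.
move=> sP [oJ oK [JP KP _ wK]]; split=> //; split=> //.
  by apply: word_W; apply/letters_rev.
rewrite -wK -[RHS]image_id image_comp; apply: eq_imagel => v _ /=.
by rewrite (word_revK Pi1).
Qed.

Lemma hom_comp L w K w' J : hom B Pi ob L w K -> hom B Pi ob K w' J ->
  hom B Pi ob L (w \o w') J.
Proof.
move=> hw hw'; have [s sP E] := hom_word hw; have [t tP E'] := hom_word hw'.
case: hw hw' => oL oK [LP KP _ wK] [_ oJ [_ JP _ w'J]].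
split=> //; split=> //; last by rewrite -image_comp w'J.
rewrite E E' (_ : _ \o _ = word B (s ++ t)); last by apply/funext => v; rewrite word_cat.
by apply: word_W; exact/letters_cat.
Qed.

Lemma hom_id J : ob J -> hom B Pi ob J id J.
Proof.
move=> oJ; have JP := ob_simple oJ; split=> //; split=> //; last exact: image_id.
exact: (@word_W [::]).
Qed.

Lemma hom_perp J w K v : hom B Pi ob J w K -> perp B K v -> perp B J (w v).
Proof.
move=> hw; have [s sP E] := hom_word hw; case: hw => _ _ [_ _ _ <-] Kv.
by move=> _ [b Kb <-]; rewrite E (word_form Pi1 sP) Kv.
Qed.

(** The Tits cone of J is the part orthogonal to J of the Tits cone of the
    Coxeter group. *)
Lemma cXP J v : ob J -> cX B Pi ob J v <-> perp B J v /\ tits B Pi (B v).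
Proof.
move=> oJ; split=> [[K [w [hw [c Cc <-]]]]|[Pv tv]].
  have [s sP E] := hom_word hw; have [_ oK [_ KP _ _]] := hw.
  move/(cCP Pi (ob_sum oK)): Cc => [Pc dc].
  split; first exact: hom_perp Pc.
  exists (rev s); first exact/letters_rev.
  by rewrite E -(dual_word_form Pi1) // (dual_word_revK Pi1).
have [|d [dP dd Jd]] := tits_vanish HPi (ob_simple oJ) tv; first exact: Pv.
have hd := ob_image oJ dP Jd; have [oK _ [KP _ _ _]] := hd.
exists (word B d @` J), (word B (rev d)); split; first exact: hom_sym.
exists (word B d v); last by rewrite (word_revK Pi1).
apply/(cCP Pi (ob_sum oK)); split; first exact: hom_perp Pv.
by rewrite -(dual_word_form Pi1).
Qed.

Lemma cKP K v : ob K -> cK B Pi K v <->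
  [/\ perp B K v, dominant Pi (B (- v)) & cone Pi v].
Proof.
move=> oK; have KP := ob_simple oK; have fK := ob_fin oK; have sK := ob_sum oK.
split=> [[[c /(cCP Pi sK)[Pc dc] <-] /(cone_DeltaP HPi KP fK sK)[]]|[Pv dv Cv]].
  by move=> ? ?; rewrite opprK; split.
split; last exact/(cone_DeltaP HPi KP fK sK).
exists (- v); last exact: opprK.
by apply/(cCP Pi sK); split=> //; exact: perpN.
Qed.

Lemma cYP J v : ob J -> cY B Pi ob J v <->
  perp B J v /\ forall K w, hom B Pi ob K w J -> cone Pi (w v).
Proof.
move=> oJ; split=> [Yv|[Pv H] K w hw].
  split.
    have [c Cc <-] := Yv _ _ (hom_id oJ).
    exact: (perp_cone_Delta (ob_sum oJ) Cc).
  move=> K w hw; have [s sP E] := hom_word hw; rewrite E in hw *.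
  have [c Cc <-] := Yv _ _ (hom_sym sP hw).
  rewrite (word_Krev Pi1) //; have [oK _ _] := hw.
  exact: (cone_Delta HPi (ob_simple oK) (ob_fin oK) (ob_sum oK) Cc).
have [s sP E] := hom_word hw; rewrite E in hw *.
exists (word B (rev s) v); last by rewrite (word_Krev Pi1).
have hw' := hom_sym sP hw; have [oK _ _] := hw'.
apply/(cone_DeltaP HPi (ob_simple oK) (ob_fin oK) (ob_sum oK)); split.
  exact: hom_perp Pv.
exact: H hw'.
Qed.

(** A family of subsets mapped into each other by all morphisms is mapped onto
    each other, as the morphisms are invertible. *)
Lemma image_hom (F : set V -> set V) J K w :
  (forall L w' L', hom B Pi ob L w' L' -> w' @` F L' `<=` F L) ->
  hom B Pi ob J w K -> w @` F K = F J.
Proof.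
move=> H hw; have [s sP E] := hom_word hw; rewrite E in hw *.
apply/seteqP; split; first exact: H.
move=> v Fv; exists (word B (rev s) v); last by rewrite (word_Krev Pi1).
by apply: (H _ _ _ (hom_sym sP hw)); exists v.
Qed.

Lemma cY_hom J w K : hom B Pi ob J w K -> w @` cY B Pi ob K = cY B Pi ob J.
Proof.
apply: image_hom => {J w K} L w L' hw _ [v Yv <-].
have [oL oL' _] := hw; move/(cYP v oL'): Yv => [Pv H].
apply/(cYP _ oL); split=> [|K w' hw']; first exact: hom_perp Pv.
exact: (H _ _ (hom_comp hw' hw)).
Qed.

Lemma cZ_hom J w K : hom B Pi ob J w K -> w @` cZ B Pi ob K = cZ B Pi ob J.
Proof.
apply: image_hom => {J w K} L w L' hw _ [_ [K [w' [hw' [k Kk <-]]]] <-].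
by exists K, (w \o w'); split; [exact: hom_comp hw'|exists k].
Qed.

(** A vector of the cone spanned by Pi at which no simple root is positive
    only grows under the Coxeter group, hence stays in that cone. *)
Lemma antidominant_cone v s : letters Pi s -> dominant Pi (B (- v)) ->
  cone Pi v -> cone Pi (word B s v).
Proof.
move=> sP dv Cv; rewrite -[word B s v](subrK v) addrC; apply: coneD => //.
have := dominant_sub_word HPi (@subset_refl _ Pi) dv sP.
by rewrite (wordN Pi1) // opprK addrC.
Qed.

(** The imaginary cone: the opposite of v is in the Tits cone, and v stays in
    the cone spanned by the simple roots under all morphisms. *)
Lemma cZP J v : ob J -> cZ B Pi ob J v <->
  [/\ perp B J v, tits B Pi (B (- v)) &
      forall K w, hom B Pi ob K w J -> cone Pi (w v)].
Proof.
move=> oJ; split.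
  move=> [K [w [hw [k Kk <-]]]]; have [s sP E] := hom_word hw.
  have [_ oK _] := hw; move/(cKP _ oK): Kk => [Pk dk Ck]; split.
  - exact: hom_perp Pk.
  - exists (rev s); first exact/letters_rev.
    by rewrite E -(wordN Pi1) // -(dual_word_form Pi1) // (dual_word_revK Pi1).
  move=> L w' hw'; have [t tP E'] := hom_word (hom_comp hw' hw).
  by rewrite -[w' _]/((w' \o w) k) E'; exact: antidominant_cone.
move=> [Pv tv Cv].
have [K [w [hw [c Cc cv]]]] : cX B Pi ob J (- v) by apply/cXP => //; split=> //; exact: perpN.
have [s sP E] := hom_word hw; rewrite E in hw cv.
have [_ oK _] := hw.
move/(cCP Pi (ob_sum oK)): Cc => [Pc dc].
exists K, (word B s); split=> //; exists (- c); last first.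
  by rewrite (wordN Pi1) // cv opprK.
apply/cKP => //; rewrite opprK; split=> //; first exact: perpN.
rewrite (_ : - c = word B (rev s) v); first exact: Cv (hom_sym sP hw).
by rewrite -[v]opprK -cv -(wordN Pi1 sP) (word_revK Pi1).
Qed.

Lemma cZ_eq J : ob J -> cZ B Pi ob J = (-%R @` cX B Pi ob J) `&` cY B Pi ob J.
Proof.
move=> oJ; apply/seteqP; split=> v.
  move=> /(cZP _ oJ)[Pv tv Cv]; split; last exact/cYP.
  exists (- v); last exact: opprK.
  by apply/cXP => //; split=> //; exact: perpN.
move=> [[x /(cXP _ oJ)[Px tx] <-] /(cYP _ oJ)[Pv Cv]].
by apply/cZP => //; rewrite opprK.
Qed.

Lemma cZ_convex J : ob J -> cZ B Pi ob J `<=` perp B J /\ convex_cone (cZ B Pi ob J).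
Proof.
move=> oJ; split=> [v /(cZP _ oJ)[]//|]; split.
- apply/cZP => //; split.
  + by move=> x _; rewrite form0l.
  + by exists [::] => // a _ /=; rewrite oppr0 form0l.
  + by move=> K w /hom_word[s sP ->]; rewrite (word0 Pi1) //; exact: cone0.
- move=> u v /(cZP _ oJ)[Pu tu Cu] /(cZP _ oJ)[Pv tv Cv]; apply/cZP => //; split.
  + exact: perpD.
  + have := titsD HPi tu tv.
    by rewrite (_ : (fun x => _) = B (- (u + v))) //; apply/funext => x;
      rewrite opprD formDl.
  + move=> K w hw; have [s sP E] := hom_word hw.
    by rewrite E (wordD Pi1) // -E; apply: coneD; [exact: Cu hw|exact: Cv hw].
- move=> c v c0 /(cZP _ oJ)[Pv tv Cv]; apply/cZP => //; split.
  + exact: perpZ.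
  + case: tv => s sP ds; exists s => // a Pa; have := ds a Pa.
    rewrite -scalerN !(dual_word_form Pi1) // (wordZ Pi1) // formZl.
    exact: mulr_ge0.
  + move=> K w hw; have [s sP E] := hom_word hw.
    by rewrite E (wordZ Pi1) // -E; apply: coneZ => //; exact: Cv hw.
Qed.

End Groupoid.

(** * Discreteness of the roots of a finite set of simple roots *)

(** In a sequence of points of a cube, two are close to each other. *)
Lemma pigeonhole_real (R : realType) (I : finType) (u : nat -> I -> R) (h e : R) :
  0 < e -> (forall n k, 0 <= u n k <= h) ->
  exists i j : nat, (i < j)%N /\ forall k, `|u i k - u j k| <= e.
Proof.
move=> e0 uh; (* Cut the cube into small cubes of side e. *)
pose M := Num.truncn (h / e).
have uM n k : (Num.truncn (u n k / e) < M.+1)%N.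
  by rewrite ltnS le_truncn // ler_pM2r ?invr_gt0 //; case/andP: (uh n k).
pose key n : {ffun I -> 'I_M.+1} := [ffun k => Ordinal (uM n k)].
have [i [j [ij E]]] : exists i j : nat, (i < j)%N /\ key i = key j.
  have [inj|] := pselect (injective (fun i : 'I_(#|{ffun I -> 'I_M.+1}|.+1) => key i)).
    by have := leq_card _ inj; rewrite card_ord ltnn.
  move=> /existsNP[i /existsNP[j /not_implyP[E ij]]].
  have [lt|lt|/val_inj//] := ltngtP (val i) (val j); first by exists (val i), (val j).
  by exists (val j), (val i).
exists i, j; split=> // k.
have /(congr1 val) /= tE : key i k = key j k by rewrite E.
move: tE; rewrite !ffunE /= => tE.
have ge n : 0 <= u n k / e by rewrite divr_ge0 ?(ltW e0) //; case/andP: (uh n k).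
have /andP[i1 i2] := truncn_itv (ge i); have /andP[j1 j2] := truncn_itv (ge j).
rewrite -tE in j1 j2; rewrite -[e]mul1r -ler_pdivrMr //.
rewrite -[X in _ / X](gtr0_norm e0) -normf_div mulrBl ler_norml.
move: i1 i2 j1 j2; rewrite -natr1; lra.
Qed.

Section Discrete.
Variables (R : realType) (V : lmodType R) (B : {symmetric V}) (Pi : set V).
Hypothesis HPi : based_root_system B Pi.
Variable S : seq V.
Hypothesis uS : uniq S.
Hypothesis SPi : letters Pi S.
Implicit Types (a b c x : V) (f g : V -> R) (s t u : seq V).

Let Pi1 := simple_norm HPi.

(** The height of a formal root is its value at this function. *)
Definition one : V -> R := fun=> 1.

Lemma dominant_one : dominant Pi one.
Proof. by move=> a _; exact: ler01. Qed.

Lemma letters_simple s : {subset s <= S} -> letters Pi s.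
Proof. by move=> sS a /sS/SPi. Qed.

(** The reflection in the root [u a] acts on functions by subtracting a
    multiple of B([u a], -). *)
Lemma dual_word_reflection u a f x : letters Pi u ->
  dual_word B (rcons u a ++ rev u) f x = f x - 2 * B (word B u a) x * lift B u a f.
Proof.
move=> uP; rewrite dual_word_cat dual_word_rcons.
rewrite (_ : dual_refl B a _ = fun v =>
    dual_word B (rev u) f v + (- 2 * lift B u a f) * B a v); last first.
  by apply/funext => v; rewrite /dual_refl -/(lift B u a f) (formC B v a); ring.
rewrite dual_wordD dual_wordZ (dual_word_Krev Pi1) // (dual_word_form Pi1) //.
by ring.
Qed.

(** An element of the group generated by S that maps every element of S to a
    positive root is the identity. *)
Lemma pos_word_id s : {subset s <= S} ->
  (forall b, b \in S -> cone Pi (word B s b)) -> word B s = id.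
Proof.
move=> sS Hs.
pose Q k := exists t, [/\ size t = k, {subset t <= S} & word B t = word B s].
have exQ : exists k, `[< Q k >] by exists (size s); apply/asboolP; exists s.
case: (ex_minnP exQ) => k /asboolP[t [tk tS E]] kmin; rewrite -E.
case/lastP: t tk tS E => [//|t b] tk tS E.
have bS : b \in S by apply: tS; rewrite mem_rcons mem_head.
have tS' : {subset t <= S} by move=> c ct; apply: tS; rewrite mem_rcons inE ct orbT.
have tP := letters_simple tS'; have Pb := SPi bS.
have := Hs b bS; rewrite -E word_rcons refl_self ?Pi1 // (wordN Pi1 tP).
move=> /(exchange HPi tP Pb)[t1 [c [t2 [Et Et']]]].
have /kmin : `[< Q (size (t1 ++ t2)) >].
  apply/asboolP; exists (t1 ++ t2); split; rewrite -?Et' //.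
  move=> d; rewrite mem_cat => dt; apply: tS'; rewrite Et mem_cat inE.
  by case/orP: dt => ->; rewrite ?orbT.
by rewrite -tk size_rcons Et !size_cat /=; lia.
Qed.

Lemma sum_bound (F g : V -> R) (m M : R) : (forall c, c \in S -> `|F c| <= m) ->
  (forall c, c \in S -> `|g c| <= M) ->
  `|\sum_(c <- S) F c * g c| <= (size S)%:R * (m * M).
Proof.
move=> Fm gM; apply: le_trans (ler_norm_sum _ _ _) _.
rewrite mulr_natl -iter_addr_0 -[size S]count_predT -big_const_seq.
rewrite big_seq [leRHS]big_seq; apply: ler_sum => c cS.
by rewrite normrM ler_pM // ?Fm ?gM.
Qed.

Lemma sum_bound_height (F g : V -> R) (h M : R) : 0 <= M ->
  (forall c, c \in S -> 0 <= F c) -> \sum_(c <- S) F c <= h ->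
  (forall c, c \in S -> `|g c| <= M) -> `|\sum_(c <- S) F c * g c| <= h * M.
Proof.
move=> M0 F0 Fh gM; apply: le_trans (ler_norm_sum _ _ _) _.
apply: le_trans (_ : \sum_(c <- S) F c * M <= _); last first.
  by rewrite -mulr_suml ler_wpM2r.
rewrite big_seq [leRHS]big_seq; apply: ler_sum => c cS.
by rewrite normrM ger0_norm ?F0 // ler_wpM2l ?F0 ?gM.
Qed.

(** Two positive roots of bounded height whose coordinates are close coincide:
    the product of the two reflections is close to the identity, hence maps
    each simple root to a root of positive height. *)
Lemma close_roots_eq (h : R) : exists2 e : R, 0 < e & forall u a u' a',
  {subset u <= S} -> a \in S -> {subset u' <= S} -> a' \in S ->
  cone Pi (word B u a) -> cone Pi (word B u' a') ->
  lift B u a one <= h -> lift B u' a' one <= h ->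
  (forall c, c \in S -> `|lift B u a (coord c) - lift B u' a' (coord c)| <= e) ->
  word B u a = word B u' a'.
Proof.
have [h0|h0] := ltP h 0.
  exists 1 => // u a u' a' uS' aS _ _ Cu _ hu.
  have k0 := pos_liftP HPi (letters_simple uS') (SPi aS) Cu dominant_one.
  by have := le_lt_trans (le_trans k0 hu) h0; rewrite ltxx.
pose M : R := \sum_(c <- S) \sum_(d <- S) `|B c d|.
have M0 : 0 <= M by do 2 apply: sumr_ge0 => ? _.
have BM c d : c \in S -> d \in S -> `|B c d| <= M.
  move=> cS dS; rewrite /M (bigD1_seq c) //= (bigD1_seq d) //= -addrA lerDl.
  by rewrite addr_ge0 //; do ?[apply: sumr_ge0 => ? _].
pose n : R := (size S)%:R; have n0 : 0 <= n by rewrite ler0n.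
(* With n e C < 1, the height of each simple root changes by less than 1 under
   the product of the two reflections. *)
pose C := 4 * h * M + 4 * (h * M) * (h * M) * h.
have C0 : 0 <= C by rewrite /C; do ?[apply: addr_ge0|apply: mulr_ge0].
pose e := (n * C + 1)^-1.
have nC0 : 0 < n * C + 1 by rewrite ltr_wpDl ?mulr_ge0.
have e0 : 0 < e by rewrite invr_gt0.
have neC : n * e * C < 1.
  by rewrite mulrAC ltr_pdivrMr // mul1r ltrDl.
exists e => // u a u' a' uS' aS u'S a'S Cu Cu' hu hu' close.
have uP := letters_simple uS'; have u'P := letters_simple u'S.
have Pa := SPi aS; have Pa' := SPi a'S.
set x := fun c => lift B u a (coord c); set y := fun c => lift B u' a' (coord c).
set p := word B u a; set q := word B u' a'.
have x0 c : 0 <= x c by exact: (pos_liftP HPi uP Pa Cu (dominant_coord c)).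
have y0 c : 0 <= y c by exact: (pos_liftP HPi u'P Pa' Cu' (dominant_coord c)).
have pE d : B p d = \sum_(c <- S) x c * B c d.
  rewrite /p (word_coord Pi1 uS uP uS' aS) form_suml.
  by apply: eq_bigr => c _; rewrite formZl.
have qE d : B q d = \sum_(c <- S) y c * B c d.
  rewrite /q (word_coord Pi1 uS u'P u'S a'S) form_suml.
  by apply: eq_bigr => c _; rewrite formZl.
have hx : lift B u a one = \sum_(c <- S) x c.
  by rewrite (lift_coord B one uS uP uS' aS); apply: eq_bigr => c _; rewrite mulr1.
have hy : lift B u' a' one = \sum_(c <- S) y c.
  by rewrite (lift_coord B one uS u'P u'S a'S); apply: eq_bigr => c _; rewrite mulr1.
set k := lift B u a one in hu hx *; set k' := lift B u' a' one in hu' hy *.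
have k0 : 0 <= k by exact: (pos_liftP HPi uP Pa Cu dominant_one).
have dk : `|k - k'| <= n * e.
  rewrite hx hy -sumrB -[e]mulr1.
  under eq_bigr do rewrite -[_ - _]mulr1.
  by apply: (@sum_bound (fun c => x c - y c) one) => // c _; rewrite normr1.
have pM d : d \in S -> `|B p d| <= h * M.
  by move=> dS; rewrite pE sum_bound_height -?hx // => c cS; exact: BM.
have qM d : d \in S -> `|B q d| <= h * M.
  by move=> dS; rewrite qE sum_bound_height -?hy // => c cS; exact: BM.
have pqM d : d \in S -> `|B q d - B p d| <= n * (e * M).
  move=> dS; rewrite pE qE -sumrB; under eq_bigr do rewrite -mulrBl.
  apply: (@sum_bound (fun c => y c - x c) (fun c => B c d)) => c cS; last exact: BM.
  by rewrite distrC close.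
have pq : `|B p q - 1| <= n * (e * (h * M)).
  have -> : B p q - 1 = \sum_(c <- S) (y c - x c) * B c p.
    rewrite -(word_norm HPi uP Pa) -/p formC qE pE -sumrB.
    by apply: eq_bigr => c _; rewrite mulrBl.
  apply: (@sum_bound (fun c => y c - x c) (fun c => B c p)) => c cS.
    by rewrite distrC close.
  by rewrite formC pM.
pose w := (rcons u a ++ rev u) ++ (rcons u' a' ++ rev u').
have rS v b : {subset v <= S} -> b \in S -> {subset rcons v b ++ rev v <= S}.
  move=> vS bS d; rewrite mem_cat mem_rcons inE mem_rev => /orP[/orP[/eqP->//|]|];
  exact: vS.
have wS : {subset w <= S}.
  by move=> d; rewrite mem_cat => /orP[]; apply: rS.
have rev_refl v b : rev (rcons v b ++ rev v) = rcons v b ++ rev v.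
  by rewrite rev_cat revK rev_rcons -cat_rcons.
have /(pos_word_id wS) wid : forall b, b \in S -> cone Pi (word B w b).
  move=> b bS; have wP := letters_simple wS; have Pb := SPi bS.
  have [//|Nw] := root_sign HPi wP Pb.
  have wbP : letters Pi (rcons w b) by exact/letters_rcons.
  have Cw : cone Pi (word B (rcons w b) b).
    by rewrite word_rcons refl_self ?Pi1 // (wordN Pi1 wP).
  have := pos_liftP HPi wbP Pb Cw dominant_one.
  rewrite (lift_rcons_self HPi) // oppr_ge0 leNgt => /negP[].
  rewrite /lift rev_cat !rev_refl dual_word_cat dual_word_reflection //.
  rewrite dual_word_reflection // -/p -/q -/k /lift.
  rewrite (_ : dual_word B (rcons u a ++ rev u) one =
      fun v => one v + (- 2 * k) * B p v); last first.
    by apply/funext => v; rewrite dual_word_reflection // -/k; ring.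
  rewrite -/(lift B u' a' _) liftD liftZ (lift_form Pi1) //.
  rewrite -/k' -/q /one.
  have -> : 1 - 2 * B p b * k - 2 * B q b * (k' + - 2 * k * B p q) =
      1 + (2 * (B q b * (k - k')) + 2 * ((B q b - B p b) * k) +
           4 * (B q b * (B p q - 1) * k)) by ring.
  suff : `|2 * (B q b * (k - k')) + 2 * ((B q b - B p b) * k) +
           4 * (B q b * (B p q - 1) * k)| < 1.
    by rewrite ltr_norml; lra.
  have T1 : `|B q b * (k - k')| <= (h * M) * (n * e).
    by rewrite normrM ler_pM // qM.
  have T2 : `|(B q b - B p b) * k| <= (n * (e * M)) * h.
    by rewrite normrM ler_pM ?pqM // ger0_norm.
  have T3 : `|B q b * (B p q - 1) * k| <= (h * M) * (n * (e * (h * M))) * h.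
    by rewrite !normrM ler_pM ?(ger0_norm k0) ?mulr_ge0 // ler_pM ?qM.
  apply: le_lt_trans neC; apply: le_trans (ler_normD _ _) _.
  apply: le_trans (lerD (ler_normD _ _) (lexx _)) _.
  rewrite ![`|_ * (_ * _)|]normrM !normr_nat.
  by move: T1 T2 T3; rewrite /C; set A1 := `|_|; set A2 := `|_|; set A3 := `|_|; lra.
have refl_rw v b x' : letters Pi v -> Pi b ->
    word B (rcons v b ++ rev v) x' = refl B (word B v b) x'.
  move=> vP Pb; rewrite word_cat word_rcons -(refl_word Pi1) ?Pi1 //.
  by rewrite (word_Krev Pi1).
have p1 : B p p = 1 by exact: (word_norm HPi).
have q1 : B q q = 1 by exact: (word_norm HPi).
have E : q = (B q p) *: p.
  have := congr1 (@^~ q) wid; rewrite /= word_cat !refl_rw // -/p -/q refl_self //.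
  rewrite reflE // formNl mulrN scaleNr opprK => E.
  have : 2 *: q = 2 *: (B q p *: p).
    by rewrite scalerA scaler_nat mulr2n -{1}E addrAC addNr add0r.
  by apply: scalerI; rewrite pnatr_eq0.
have : B q p ^+ 2 = 1.
  by rewrite -q1 [in RHS]E formZl formZr p1 mulr1 expr2.
move=> /eqP; rewrite sqrf_eq1 => /orP[] /eqP H; move: E; rewrite H ?scale1r //.
rewrite scaleN1r => E; case: (root_not_both HPi uP Pa Cu).
by rewrite -/p -E.
Qed.

End Discrete.

(** * Imaginary realized roots *)

Section Imaginary.
Variables (R : realType) (V : lmodType R) (B : {symmetric V}) (Pi : set V).
Variable ob : set (set V).
Hypothesis HPi : based_root_system B Pi.
Hypothesis Hob : bh_groupoid B Pi ob.
Hypothesis Hadm : forall K, ob K -> admissible B Pi K.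
Implicit Types (K : set V) (x b c : V) (f g : V -> R) (s y w d : seq V).

(** The root r is written as t a0, with a word t and a simple root a0. *)
Variables (J : set V) (t : seq V) (a0 : V).
Hypothesis oJ : ob J.
Hypothesis tP : letters Pi t.
Hypothesis Pa0 : Pi a0.
Let r := word B t a0.
Let a := proj B J r.
Hypothesis Cr : cone Pi r.
Hypothesis a_neq0 : a <> 0.
Hypothesis Ca : forall K (w : V -> V), hom B Pi ob K w J -> cone Pi (w a).

(** S is a finite set of simple roots carrying r, such that J outside S is
    orthogonal to S. The intersection D of J and S has an averaging family of
    words Y. *)
Variables (D S : seq V) (Y : seq (seq V)).
Hypothesis uS : uniq S.
Hypothesis SPi : letters Pi S.
Hypothesis tS : {subset t <= S}.
Hypothesis a0S : a0 \in S.
Hypothesis DS : {subset D <= S}.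
Hypothesis DJ : letters J D.
Hypothesis JSD : forall b, b \in S -> J b -> b \in D.
Hypothesis Sorth : forall c b, c \in S -> J b -> b \notin S -> B c b = 0.
Hypothesis Y0 : (0 < size Y)%N.
Hypothesis YD : forall y, y \in Y -> letters [set` D] y.
Hypothesis kY : kills B [set` D] Y.
Hypothesis Yrev : forall h : seq V -> R,
  \sum_(y <- Y) h (rev y) = \sum_(y <- Y) h y.

Let Pi1 := simple_norm HPi.
Let JPi := ob_simple Hob oJ.
Let JJ := ob_fin Hadm oJ.
Let Jsum := ob_sum Hadm oJ.

Lemma S_letters s : {subset s <= S} -> letters Pi s.
Proof. by move=> sS b /sS/SPi. Qed.

Lemma Y_lettersJ y : y \in Y -> letters J y.
Proof. by move=> /YD; exact: letters_sub. Qed.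

Lemma Y_sub_S y : y \in Y -> {subset y <= S}.
Proof. by move=> /YD yD b /yD /DS. Qed.

Lemma Y_letters y : y \in Y -> letters Pi y.
Proof. by move/Y_sub_S/S_letters. Qed.

Lemma a_perp : perp B J a.
Proof. by have [] := proj_spec Jsum r. Qed.

Lemma ra_lspan : lspan J (r - a).
Proof. by have [] := proj_spec Jsum r. Qed.

Lemma r_notin_lspan : ~ lspan J r.
Proof. by move=> Lr; apply: a_neq0; exact: proj_lspan. Qed.

Lemma lspan_word y : letters J y -> lspan J (word B y r - r).
Proof.
by move=> yJ; apply: (word_lspan Pi1) => //; exact: letters_sub JPi yJ.
Qed.

(** A positive multiple of a is a sum of roots in the orbit of r under the
    parabolic subgroup of D. *)
Lemma orbit_sum : \sum_(y <- Y) word B (y ++ t) a0 = (size Y)%:R *: a.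
Proof.
under eq_bigr do rewrite word_cat -/r.
have Ps : perp B J (\sum_(y <- Y) word B y r).
  move=> b Jb; rewrite form_suml.
  transitivity (\sum_(y <- Y) dual_word B y (B r) b).
    rewrite big_seq [RHS]big_seq; apply: eq_bigr => y yY.
    by rewrite (dual_word_form Pi1 _ (Y_letters yY)).
  have [bD|bD] := boolP (b \in D); first exact: kY.
  have bS : b \notin S by apply: contraNN bD => bS; exact: JSD.
  rewrite big_seq big1 // => y yY; rewrite dual_word_orth; last first.
    by move=> c /(Y_sub_S yY) cS; rewrite formC Sorth.
  rewrite /r (word_coord Pi1 uS tP tS a0S) form_suml big_seq big1 // => c cS.
  by rewrite formZl Sorth ?mulr0.
rewrite -(proj_id Jsum Ps) /a -(projZ Jsum); apply: (proj_uniq Jsum).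
  by rewrite (projZ Jsum); apply: perpZ; exact: a_perp.
rewrite (_ : _ - _ = \sum_(y <- Y) (word B y r - r) + (size Y)%:R *: (r - a)).
  apply: lspanD; last by apply: lspanZ; exact: ra_lspan.
  by rewrite big_seq; apply: lspan_sum => y /Y_lettersJ yJ; exact: lspan_word.
rewrite (projZ Jsum) sumrB big_const_seq count_predT iter_addr_0 -scaler_nat.
by rewrite scalerBr addrA subrK.
Qed.

(** A root that changes sign under the parabolic subgroup of J is a combination
    of elements of J; r is not, because its projection a is non-zero. *)
Lemma orbit_pos y : letters J y -> cone Pi (word B (y ++ t) a0).
Proof.
move=> yJ; have yP := letters_sub JPi yJ.
have ytP : letters Pi (y ++ t) by exact/letters_cat.
have [//|N] := root_sign HPi ytP Pa0.
have [|y1 [d [y2 [E Ed]]]] := sign_change HPi yP tP Pa0 Cr; first by rewrite -word_cat.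
exfalso; apply: r_notin_lspan; rewrite -/r in Ed.
have [_ /letters_cons[Jd y2J]] : letters J y1 /\ letters J (d :: y2).
  by apply/letters_cat; rewrite -E.
have := lspan_word y2J; rewrite Ed => H.
rewrite (_ : r = d - (d - r)); last by rewrite opprB addrCA subrr addr0.
by apply: lspanD; [exact: lspan_mem|exact: lspanN].
Qed.

(** The root r stays positive under the morphisms starting at J. *)
Lemma hom_pos d : letters Pi d -> (forall b, J b -> Pi (word B d b)) ->
  cone Pi (word B (d ++ t) a0).
Proof.
move=> dP dJ; have hd := ob_image HPi Hob oJ dP dJ.
set K := _ @` J in hd; have [oK _ _] := hd.
have dtP : letters Pi (d ++ t) by exact/letters_cat.
have [//|N] := root_sign HPi dtP Pa0; exfalso; apply: a_neq0.
have Ksum := ob_sum Hadm oK.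
have E : proj B K (word B (d ++ t) a0) = word B d a.
  apply: (proj_uniq Ksum); first exact: (hom_perp HPi hd a_perp).
  rewrite word_cat -/r -(wordB Pi1 dP); move: (r - a) ra_lspan.
  apply: lspan_ind.
  - by rewrite (word0 Pi1 dP); exact: lspan0.
  - by move=> u v Lu Lv; rewrite (wordD Pi1 dP); exact: lspanD.
  - move=> c v Jv; rewrite (wordZ Pi1 dP); apply/lspanZ/lspan_mem.
    by exists v.
have da0 : word B d a = 0.
  apply: (cone_pointed HPi); first exact: Ca hd.
  rewrite -E -scaleN1r -(projZ Ksum) scaleN1r.
  apply: (cone_Delta HPi (ob_simple Hob oK) (ob_fin Hadm oK) Ksum).
  exact: proj_cone.
by rewrite -(word_revK Pi1 dP a) da0 (word0 Pi1) //; exact/letters_rev.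
Qed.

(** The formal vector above the multiple of w a given by [orbit_sum]. *)
Let lifta w f : R := \sum_(y <- Y) lift B (w ++ y ++ t) a0 f.

Lemma lifta_letters w y : {subset w <= S} -> y \in Y -> {subset w ++ y ++ t <= S}.
Proof.
move=> wS yY b; rewrite !mem_cat => /or3P[|bs|]; [exact: wS| |exact: tS].
exact: (Y_sub_S yY).
Qed.

(** The coordinates of all formal vectors above the images of a under the
    group generated by S are non-negative. A coordinate is the value of a
    at a function in the dual Tits cone; averaging makes that function vanish
    on J, so that it becomes dominant under a morphism starting at J, under
    which r remains a positive root. *)
Lemma lifta_coord w c : {subset w <= S} -> c \in S -> 0 <= lifta w (coord c).
Proof.
move=> wS cS; have rwS : {subset rev w <= S} by move=> b; rewrite mem_rev; exact: wS.
rewrite /lifta; under eq_bigr do rewrite lift_cat lift_cat.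
set g := dual_word B (rev w) (coord c).
rewrite (Yrev (fun y => lift B t a0 (dual_word B y g))) -lift_sum.
set G := fun v => _.
have tG : tits B Pi G.
  apply: (tits_sum HPi) => y /Y_letters yP.
  apply: (tits_dual HPi yP); apply: (tits_dual HPi); first exact: S_letters.
  by exists [::] => //; exact: dominant_coord.
have GJ b : J b -> G b = 0.
  move=> Jb; have [bD|bD] := boolP (b \in D); first exact: kY.
  have bS : b \notin S by apply: contraNN bD => bS; exact: JSD.
  rewrite /G big_seq big1 // => y yY; rewrite dual_word_orth; last first.
    by move=> d /(Y_sub_S yY) dS; rewrite formC Sorth.
  rewrite /g dual_word_orth; last by move=> d /rwS dS; rewrite formC Sorth.
  by rewrite /coord; case: eqP => // bc; rewrite bc cS in bS.
have [d [dP dG dJ]] := tits_vanish HPi JPi tG GJ.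
rewrite -[G](dual_word_revK Pi1 _ dP) -lift_cat.
apply: (pos_liftP HPi _ Pa0 (hom_pos dP dJ)) => //.
exact/letters_cat.
Qed.

Lemma liftaE w f : {subset w <= S} ->
  lifta w f = \sum_(c <- S) lifta w (coord c) * f c.
Proof.
move=> wS; rewrite /lifta; under [RHS]eq_bigr do rewrite mulr_suml.
rewrite exchange_big /= big_seq [RHS]big_seq; apply: eq_bigr => y yY.
have wyS := lifta_letters wS yY.
exact: (lift_coord B f uS (S_letters wyS) wyS a0S).
Qed.

Lemma lifta_form w x : {subset w <= S} ->
  lifta w (B x) = B x (word B w ((size Y)%:R *: a)).
Proof.
move=> wS; have wP := S_letters wS; rewrite -orbit_sum (word_sum Pi1 wP) form_sumr.
rewrite /lifta big_seq [RHS]big_seq; apply: eq_bigr => y yY.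
by rewrite (lift_form Pi1) ?word_cat //; exact/S_letters/lifta_letters.
Qed.

(** The sum of the coordinates of the formal vector above w a. *)
Let height w : R := lifta w (one (V := V)).

Lemma height_cons b w : {subset w <= S} ->
  height (b :: w) = height w - 2 * B b (word B w ((size Y)%:R *: a)).
Proof.
move=> wS; rewrite -lifta_form // /height /lifta mulr_sumr -sumrB.
apply: eq_bigr => y _; rewrite /= lift_cons.
rewrite (_ : dual_refl B b _ = fun v => one v + (- 2) * B b v).
  by rewrite liftD liftZ mulNr.
by apply/funext => v; rewrite /dual_refl /one (formC B v b); ring.
Qed.

Lemma height_ge0 w : {subset w <= S} -> 0 <= height w.
Proof.
move=> wS; rewrite /height liftaE // big_seq; apply: sumr_ge0 => c cS.
by rewrite mulr1 lifta_coord.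
Qed.

Lemma sizeY_gt0 : 0 < (size Y)%:R :> R.
Proof. by rewrite ltr0n. Qed.

(** If a had positive norm, the height could be lowered by a fixed amount
    infinitely often by simple reflections. *)
Lemma a_norm_le0 : B a a <= 0.
Proof.
have N0 := sizeY_gt0; rewrite leNgt; apply/negP => aa; set A := (size Y)%:R *: a.
pose b := B A A; have b0 : 0 < b by rewrite /b formZl formZr !mulr_gt0.
have nS : {subset [::] <= S} by [].
pose h0 := height [::] + 1.
have h00 : 0 < h0 by have := height_ge0 nS; rewrite /h0; lra.
pose e := b / (2 * h0); have e0 : 0 < e by apply: divr_gt0 => //; exact: mulr_gt0.
have drop w : {subset w <= S} -> height w <= h0 ->
    exists2 c, c \in S & height (c :: w) <= height w - 2 * e.
  move=> wS wh; have [c cS ce] : exists2 c, c \in S & e <= B c (word B w A).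
    apply: contrapT => /forall2NP H.
    have : b <= height w * e.
      rewrite /b -(word_form Pi1 (S_letters wS)) -lifta_form // liftaE //.
      rewrite /height liftaE // mulr_suml big_seq [leRHS]big_seq.
      apply: ler_sum => c cS; rewrite mulr1 ler_wpM2l ?lifta_coord // ltW //.
      by rewrite formC ltNge; apply/negP; case: (H c).
    apply/negP; rewrite -ltNge (@le_lt_trans _ _ (h0 * e)) ?ler_pM2r //.
    have -> : h0 * e = b / 2 by rewrite /e; field; rewrite gt_eqF.
    lra.
  by exists c => //; rewrite height_cons // -/A; lra.
have low n w : {subset w <= S} -> height w <= h0 -> n%:R * (2 * e) <= height w.
  elim: n w => [|n IH] w wS wh; first by rewrite mul0r height_ge0.
  have [c cS le] := drop w wS wh.
  have := IH (c :: w); rewrite -natr1 => /(_ _ _)H.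
  suff : n%:R * (2 * e) <= height (c :: w) by lra.
  apply: H; last lra.
  by move=> d; rewrite inE => /orP[/eqP->|/wS].
have := low (Num.truncn (h0 / (2 * e))).+1 [::] nS.
have h1 : height [::] <= h0 by rewrite /h0; lra.
move=> /(_ h1); apply/negP; rewrite -ltNge; apply: le_lt_trans h1 _.
have e2 : 0 < 2 * e by lra.
rewrite -(ltr_pdivrMr _ _ e2).
have q0 : 0 <= h0 / (2 * e).
  by apply: divr_ge0; exact: ltW.
by have /andP[_] := truncn_itv q0.
Qed.

(** The simple reflections that lower the height keep all the roots in the
    sum for a positive, because a has non-positive product with these roots.
    As the heights of these roots stay bounded, there are finitely many
    possibilities for them, so that the lowering must come to an end. *)
Lemma imaginary_tits_block : tits B Pi (B (- a)).
Proof.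
have N0 := sizeY_gt0; apply: contrapT => ntits; set A := (size Y)%:R *: a.
pose good w := {subset w <= S} /\
  forall y, y \in Y -> cone Pi (word B (w ++ y ++ t) a0).
(* A simple reflection that lowers the height. *)
have step w : exists w', good w -> good w' /\ height w' < height w.
  have [[wS wY]|ng] := pselect (good w); last by exists w.
  have wP := S_letters wS.
  have [b Pb ab] : exists2 b, Pi b & 0 < B b (word B w a).
    apply: contrapT => /forall2NP H; apply: ntits; exists w => // b Pb.
    rewrite (dual_word_form Pi1) // (wordN Pi1) // formNl oppr_ge0 formC leNgt.
    by apply/negP; case: (H b).
  have Ab : 0 < B b (word B w A) by rewrite (wordZ Pi1 wP) formZr mulr_gt0.
  have bS : b \in S.
    apply: contraTT Ab => bS; rewrite -leNgt -lifta_form // liftaE // big_seq.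
    apply: sumr_le0 => c cS; rewrite mulr_ge0_le0 ?lifta_coord //.
    apply: (simple_form_le0 HPi Pb (SPi cS)) => bc.
    by rewrite bc cS in bS.
  exists (b :: w) => _; split; last by rewrite height_cons // -/A; lra.
  split=> [d|y yY]; first by rewrite inE => /orP[/eqP->|/wS].
  have wyP := S_letters (lifta_letters wS yY).
  apply: (refl_pos HPi Pb wyP Pa0 (wY y yY)) => E.
  move: ab; apply/negP; rewrite -leNgt -E word_cat (word_form Pi1 wP) word_cat -/r.
  rewrite -[word B y r](subrK r) formDl formC (perp_lspan a_perp); last exact/lspan_word/Y_lettersJ.
  rewrite add0r formC -(form_proj Jsum r a_perp); exact: a_norm_le0.
have [F HF] := choice step.
(* Along the infinite sequence obtained, two members give close coordinates
   to all the roots, hence give the same roots and the same height. *)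
pose w n := iter n F [::].
have wgood n : good (w n).
  elim: n => [|n IH]; last by have [] := HF _ IH.
  by split=> // y yY; apply/orbit_pos/Y_lettersJ.
have wlt i j : (i < j)%N -> height (w j) < height (w i).
  elim: j => // j IH; rewrite ltnS leq_eqVlt => /orP[/eqP->|/IH lt].
    by have [] := HF _ (wgood j).
  by apply: lt_trans lt; have [] := HF _ (wgood j).
pose h := height [::].
have wh n : height (w n) <= h.
  by case: n => [|n]; [exact: lexx|exact/ltW/(wlt 0%N)].
have wyS n y : y \in Y -> {subset w n ++ y ++ t <= S}.
  by move=> yY; apply: lifta_letters => //; have [] := wgood n.
have wpos n y f : y \in Y -> dominant Pi f -> 0 <= lift B (w n ++ y ++ t) a0 f.
  move=> yY df; have [_ wY] := wgood n.
  exact: (pos_liftP HPi (S_letters (wyS n y yY)) Pa0 (wY y yY) df).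
have d1 : dominant Pi (one (V := V)) by exact: dominant_one.
have wyh n y : y \in Y -> lift B (w n ++ y ++ t) a0 (one (V := V)) <= h.
  move=> yY; apply: le_trans (wh n); rewrite /height /lifta.
  rewrite (big_rem y) //= lerDl big_seq; apply: sumr_ge0 => z /mem_rem zY.
  exact: wpos.
have [e e0 He] := close_roots_eq HPi uS SPi h.
pose I := ('I_(size Y) * 'I_(size S))%type.
pose u n (k : I) := lift B (w n ++ nth [::] Y k.1 ++ t) a0 (coord (nth 0 S k.2)).
have [i [j [ij close]]] : exists i j : nat, (i < j)%N /\
    forall k, `|u i k - u j k| <= e.
  apply: (pigeonhole_real (h := h)) => // n k.
  have yY : nth [::] Y k.1 \in Y by exact: mem_nth.
  have cS : nth 0 S k.2 \in S by exact: mem_nth.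
  apply/andP; split; first by apply: wpos => //; exact: dominant_coord.
  apply: le_trans (wyh n _ yY).
  rewrite (lift_coord B _ uS (S_letters (wyS n _ yY)) (wyS n _ yY) a0S).
  under eq_bigr do rewrite mulr1.
  rewrite (bigD1_seq _ cS uS) /= lerDl; apply: sumr_ge0 => c _.
  by apply: wpos => //; exact: dominant_coord.
have := wlt _ _ ij; rewrite (_ : height (w j) = height (w i)) ?ltxx //.
rewrite /height /lifta big_seq [RHS]big_seq; apply: eq_bigr => y yY.
apply: (lift_unique HPi) => //; [exact/S_letters/wyS|exact/S_letters/wyS|].
apply: He => //; try exact: wyS; try exact: wyh.
- by have [_ wY] := wgood j; exact: wY.
- by have [_ wY] := wgood i; exact: wY.
move=> c cS; rewrite distrC.
have yi : (index y Y < size Y)%N by rewrite index_mem.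
have ci : (index c S < size S)%N by rewrite index_mem.
by have := close (Ordinal yi, Ordinal ci); rewrite /u /= !nth_index.
Qed.

End Imaginary.

(** The condition that each simple root is orthogonal to almost all of J is
    used here, to find a finite set S of simple roots that carries a given root
    and is orthogonal to the rest of J. *)
Lemma imaginary_tits (R : realType) (V : lmodType R) (B : {symmetric V})
    (Pi : set V) (ob : set (set V)) (J : set V) (t : seq V) (a0 : V) :
  based_root_system B Pi -> bh_groupoid B Pi ob ->
  (forall K, ob K -> admissible B Pi K) -> ob J ->
  letters Pi t -> Pi a0 -> cone Pi (word B t a0) ->
  proj B J (word B t a0) <> 0 ->
  (forall K w, hom B Pi ob K w J -> cone Pi (w (proj B J (word B t a0)))) ->
  tits B Pi (B (- proj B J (word B t a0))).
Proof.
move=> HPi Hob Hadm oJ tP Pa0 Cr a0N Ca.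
have JP := ob_simple Hob oJ; have JJ := ob_fin Hadm oJ.
have [L LP] : exists L : seq V, forall b, b \in L <->
    J b /\ exists2 c, c \in a0 :: t & B c b != 0.
  have [F _ _] := Hadm _ oJ; rewrite -JJ in F.
  have tP' : letters Pi (a0 :: t) by exact/letters_cons.
  have /finite_seqP[L EL] :
      finite_set (\bigcup_(c in [set` a0 :: t]) [set b | J b /\ B c b != 0]).
    by apply: bigcup_finite => [|c /tP' /F]; [exact: finite_seq|exact].
  exists L => b; rewrite (_ : (b \in L) = [set` L] b :> Prop) // -EL.
  by split=> [[c ? [? ?]]|[? [c ? ?]]]; [split=> //; exists c|exists c].
have LJ : letters J L by move=> b /LP[].
have [D [Y [DJ LD Dorth [Y0 YD kY Yrev]]]] := finite_block HPi JP JJ LJ.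
pose S := undup ((a0 :: t) ++ D).
have SE b : (b \in S) = (b \in a0 :: t) || (b \in D) by rewrite mem_undup mem_cat.
apply: (@imaginary_tits_block _ _ B Pi ob HPi Hob Hadm J t a0 oJ tP Pa0 Cr a0N Ca
  D S Y) => //.
- exact: undup_uniq.
- move=> b; rewrite SE inE => /orP[/orP[/eqP->//|/tP//]|/DJ/JP//].
- by move=> b bt; rewrite SE inE bt orbT.
- by rewrite SE mem_head.
- by move=> b bD; rewrite SE bD orbT.
- move=> b; rewrite SE => /orP[bt Jb|//]; apply/LD/LP; split=> //; exists b => //.
  by rewrite (simple_norm HPi) ?oner_eq0 //; exact: JP.
move=> c b; rewrite !SE negb_or => cS Jb /andP[bt bD].
case/orP: cS => [ct|cD]; last exact: Dorth.
apply/eqP; apply: contraNT bD => cb; apply/LD/LP; split=> //; by exists c.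
Qed.

Theorem theorem1p69 (R : realType) (V : lmodType R) (B : {symmetric V})
  (Pi : set V) (ob : set (set V)) (J : set V) :
  based_root_system B Pi ->
  bh_groupoid B Pi ob ->
  (forall K, ob K -> admissible B Pi K) ->
  ob J ->
  [/\ forall K w, hom B Pi ob J w K ->
        w @` cY B Pi ob K = cY B Pi ob J /\ w @` cZ B Pi ob K = cZ B Pi ob J,
      cZ B Pi ob J = (-%R @` cX B Pi ob J) `&` cY B Pi ob J,
      cZ B Pi ob J `<=` perp B J /\ convex_cone (cZ B Pi ob J) &
      UpsImP B Pi ob J `<=` cZ B Pi ob J].
Proof.
move=> HPi Hob Hadm oJ; split.
- by move=> K w hw; split; [exact: cY_hom|exact: cZ_hom].
- exact: cZ_eq.
- exact: cZ_convex.
move=> a [Ua Ha].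
(* This includes the default value 0 of [rUJ]. *)
have upos K x : ob K -> UpsP B Pi K x -> cone Pi x.
  move=> oK [U _ <-]; apply: (cone_Delta HPi (ob_simple Hob oK) (ob_fin Hadm oK) (ob_sum Hadm oK)).
  apply: (proj_cone (ob_sum Hadm oK)).
  by rewrite /rUJ; case: xgetP => [r _ [[]]//|_]; exact: cone0.
have Ca K w : hom B Pi ob K w J -> cone Pi (w a).
  by move=> hw; have [oK _ _] := hw; apply: (upos K) => //; exact: Ha.
have Z0 : cZ B Pi ob J 0 by have [_ []] := cZ_convex HPi Hob Hadm oJ.
have [->//|a0] := pselect (a = 0).
move: Ua Ha Ca a0 => [U _ <-] _ Ca a0; apply/(cZP HPi Hob Hadm _ oJ); split=> //.
  by have [] := proj_spec (ob_sum Hadm oJ) (rUJ B Pi U J).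
move: Ca a0; rewrite /rUJ; case: xgetP => [r _ [[[w Ww [b Pb ->]] Cr] _ _]|_] Ca a0.
  have /(parabolicP HPi)[//|t tP wt] := Ww.
  by rewrite wt in Cr Ca a0 *; exact: (imaginary_tits HPi Hob Hadm oJ tP Pb Cr a0 Ca).
by case: a0; apply: (proj_lspan (ob_sum Hadm oJ)); exact: lspan0.
Qed.
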